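(* Let $A$ be an Artin $R$-algebra, let $F$ be a non-zero additive subfunctor of $\mathrm{Ext}^1_A(-,-)$ with enough projectives and enough injectives, such that $\mathcal P(F)=\mathrm{add}\,G$ for some finitely generated $A$-module $G$, and let $M$ be a finitely generated $A$-module. Then $$\phi\text{-}\dim_F(M)=\max\bigl(\{d\in\mathbb Z\mid \text{there is a relative } d\text{-division of } M\}\cup\{0\}\bigr).$$
   Context: Modules are finitely generated left modules over an Artin algebra $A$ over a commutative artinian ring $R$; $A\text{-mod}$ is their category. Let $F$ be an additive subfunctor of the bifunctor $\mathrm{Ext}^1_A(-,-)$. A short exact sequence $0\to X\to Y\to Z\to 0$ is $F$-exact if its class lies in $F(Z,X)$; then $X\to Y$ is an $F$-monomorphism and $Y\to Z$ an $F$-epimorphism. A module $P$ is $F$-projective (resp. $I$ is $F$-injective) if $\mathrm{Hom}_A(P,-)$ (resp. $\mathrm{Hom}_A(-,I)$) is exact on $F$-exact sequences; $\mathcal P(F)$ is the full subcategory of $F$-projective modules. $F$ has enough projectives (injectives) if every module admits an $F$-epimorphism from an $F$-projective module (an $F$-monomorphism into an $F$-injective module). $\mathrm{Ext}^i_F(-,-)$ are the relative extension functors, computed using $F$-projective resolutions ($F$-exact resolutions by $F$-projectives); $\mathrm{Ext}^1_F=F$. $\Omega_F(M)$ is the relative syzygy, the kernel of an $F$-projective cover of $M$. $K_F(A)$ is the abelian group generated by the isomorphism classes $[M]$, $M\in A\text{-mod}$, modulo the relations $[N]=[X]+[Y]$ if $N\simeq X\oplus Y$, and $[P]=0$ if $P$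 is $F$-projective. $\Omega_F:K_F(A)\to K_F(A)$ is the endomorphism with $\Omega_F[M]=[\Omega_F(M)]$. For a module $M$, $\langle M\rangle\subseteq K_F(A)$ is the subgroup generated by the indecomposable non-$F$-projective direct summands of $M$. The number $\phi\text{-}\dim_F(M)$ (the relative Igusa–Todorov function) is the least integer $k\ge0$ such that $\Omega_F:\Omega_F^m(\langle M\rangle)\to\Omega_F^{m+1}(\langle M\rangle)$ is an isomorphism for all $m\ge k$. For a positive integer $d$, a relative $d$-division of $M$ is a pair $(X,Y)$ of objects of $\mathrm{add}(M)$ such that: (a) $\mathrm{add}(X)\cap\mathrm{add}(Y)=0$; (b) $\mathrm{Ext}^d_F(X,-)\not\simeq\mathrm{Ext}^d_F(Y,-)$; (c) $\mathrm{Ext}^{d+1}_F(X,-)\simeq\mathrm{Ext}^{d+1}_F(Y,-)$, where isomorphisms are isomorphisms of functors on $A\text{-mod}$. *)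

(* Defs.v *)
From HB Require Import structures.
From mathcomp Require Import all_boot all_order all_algebra.
From mathcomp Require Import boolp classical_sets.

Set Implicit Arguments.
Unset Strict Implicit.
Unset Printing Implicit Defensive.

Import GRing.Theory.
Local Open Scope ring_scope.
Local Open Scope quotient_scope.

Definition finitely_generated (S : pzRingType) (V : lmodType S) : Prop :=
  exists (n : nat) (e : 'I_n -> V),
    forall v : V, exists c : 'I_n -> S, v = \sum_i c i *: e i.

Definition is_ideal (R : comPzRingType) (I : set R) : Prop :=
  [/\ I 0, forall x y, I x -> I y -> I (x + y) & forall a x, I x -> I (a * x)].

Definition artinian (R : comPzRingType) : Prop :=
  forall I : nat -> set R,
    (forall n, is_ideal (I n)) ->
    (forall n, (I n.+1 `<=` I n)%classic) ->
    exists n, forall m, (n <= m)%N -> I m = I n.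

Definition artin_algebra (R : comNzRingType) (A : algType R) : Prop :=
  artinian R /\ finitely_generated (A : lmodType R).

Record fgmod (A : pzRingType) := FGMod {
  fgmod_sort :> lmodType A;
  fgmodP : finitely_generated fgmod_sort }.

Lemma prod_fg (A : pzRingType) (U V : lmodType A) :
  finitely_generated U -> finitely_generated V ->
  finitely_generated (U * V)%type.
Proof.
case=> n [e he] [m [e' he']]; exists (n + m)%N.
exists (fun k => match split k with inl i => (e i, 0) | inr j => (0, e' j) end).
case=> u v; have [c hc] := he u; have [c' hc'] := he' v.
exists (fun k => match split k with inl i => c i | inr j => c' j end).
rewrite big_split_ord /=.
under eq_bigr do rewrite (unsplitK (inl _)).
under [X in _ = _ + X]eq_bigr do rewrite (unsplitK (inr _)).
have pairs (I : finType) (x : I -> U) (y : I -> V) :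
    \sum_i (x i, y i) = (\sum_i x i, \sum_i y i).
  elim/big_rec3: _ => [|j a b p _ ->] //.
rewrite hc hc' /GRing.scale /= !pairs; congr pair; rewrite /=.
  by rewrite [X in _ + X]big1 ?addr0 // => i _; rewrite scaler0.
by rewrite [X in X + _]big1 ?add0r // => i _; rewrite scaler0.
Qed.

Definition prod_fgmod (A : pzRingType) (U V : fgmod A) : fgmod A :=
  FGMod (prod_fg (fgmodP U) (fgmodP V)).

Definition liso (A : pzRingType) (U V : lmodType A) : Prop :=
  exists f : {linear U -> V}, bijective f.

Definition is_zero (A : pzRingType) (V : lmodType A) : Prop :=
  forall v : V, v = 0.

Definition is_summand (A : pzRingType) (N M : fgmod A) : Prop :=
  exists L : fgmod A, liso M (N * L)%type.

Definition indecomposable (A : pzRingType) (N : fgmod A) : Prop :=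
  ~ is_zero N /\
  forall X Y : fgmod A, liso N (X * Y)%type -> is_zero X \/ is_zero Y.

Definition in_add (A : pzRingType) (M N : fgmod A) : Prop :=
  exists (n : nat) (L : fgmod A), liso {ffun 'I_n -> M} (N * L)%type.

Definition short_exact (U V W : zmodType) (f : U -> V) (g : V -> W) : Prop :=
  [/\ injective f,
      forall v, g v = 0 <-> (exists u, f u = v)
    & forall w, exists v, g v = w].

Section Hom.
Variables (A : pzRingType) (U V : lmodType A).

Definition hom : Type := {linear U -> V}.

HB.instance Definition _ := gen_eqMixin hom.
HB.instance Definition _ := gen_choiceMixin hom.

Lemma hom_ext (f g : {linear U -> V}) : f =1 g -> f = g.
Proof.
case: f g => [f [[a0] [b0]]] [g [[a1] [b1]]] /= /funext fg.
by subst g; congr (GRing.Linear.Pack (GRing.Linear.Class _ _));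
   [congr GRing.isNmodMorphism.Axioms_|congr GRing.isScalable.Axioms_];
   exact: Prop_irrelevance.
Qed.

Definition hom_zero : hom := \0.
Definition hom_opp (f : hom) : hom := \- (f : {linear U -> V}).
Definition hom_add (f g : hom) : hom :=
  (f : {linear U -> V}) \+ (g : {linear U -> V}).

Lemma hom_addA : associative hom_add.
Proof. by move=> f g h; apply: hom_ext => x /=; rewrite addrA. Qed.
Lemma hom_addC : commutative hom_add.
Proof. by move=> f g; apply: hom_ext => x /=; rewrite addrC. Qed.
Lemma hom_add0 : left_id hom_zero hom_add.
Proof. by move=> f; apply: hom_ext => x /=; rewrite add0r. Qed.
Lemma hom_addN : left_inverse hom_zero hom_opp hom_add.
Proof. by move=> f; apply: hom_ext => x /=; rewrite addNr. Qed.

HB.instance Definition _ :=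
  GRing.isZmodule.Build hom hom_addA hom_addC hom_add0 hom_addN.

End Hom.

Definition hcomp (A : pzRingType) (U V W : lmodType A)
  (g : {linear V -> W}) (f : {linear U -> V}) : hom U W := g \o f.

Section Extensions.
Variable A : pzRingType.

Record extension (Z X : fgmod A) := Extension {
  mid : fgmod A;
  incl : {linear X -> mid};
  prj : {linear mid -> Z};
  ext_exact : short_exact incl prj }.

Definition ext_mor (Z X Z' X' : fgmod A) (a : {linear X -> X'})
    (c : {linear Z -> Z'}) (E : extension Z X) (E' : extension Z' X') : Prop :=
  exists b : {linear mid E -> mid E'},
    (forall x, b (incl E x) = incl E' (a x)) /\
    (forall y, prj E' (b y) = c (prj E y)).

(* Ext^1_A(Z, X) is the set of extensions of Z by X up to [equivalent].  A
   morphism of extensions with identity on one side forces the corresponding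
   square to be a pushout, resp. a pullback: [pushout a E E'] says that E'
   represents a E, and [pullback c E E'] that E' represents E c. *)
Definition pushout (Z X X' : fgmod A) (a : {linear X -> X'})
  (E : extension Z X) (E' : extension Z X') := ext_mor a idfun E E'.

Definition pullback (Z' Z X : fgmod A) (c : {linear Z' -> Z})
  (E : extension Z X) (E' : extension Z' X) := ext_mor idfun c E' E.

Definition equivalent (Z X : fgmod A) (E E' : extension Z X) :=
  ext_mor idfun idfun E E'.

Definition split_ext (Z X : fgmod A) (E : extension Z X) : Prop :=
  exists s : {linear Z -> mid E}, forall z, prj E (s z) = z.

Section ProdMap.
Variables U U' V V' : lmodType A.
Definition prod_map (f : {linear U -> U'}) (g : {linear V -> V'})
  (p : U * V) : U' * V' := (f p.1, g p.2).
Lemma prod_map_linear f g : linear (prod_map f g).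
Proof. by move=> a p q; rewrite /prod_map /= !linearP. Qed.
HB.instance Definition _ f g :=
  GRing.isLinear.Build A (U * V)%type (U' * V')%type _ (prod_map f g)
    (prod_map_linear f g).
End ProdMap.

Section Diagonals.
Variable U : lmodType A.
Definition diag (u : U) : U * U := (u, u).
Lemma diag_linear : linear diag. Proof. by []. Qed.
HB.instance Definition _ :=
  GRing.isLinear.Build A U (U * U)%type _ diag diag_linear.
Definition codiag (p : U * U) : U := p.1 + p.2.
Lemma codiag_linear : linear codiag.
Proof. by move=> a p q; rewrite /codiag /= scalerDr addrACA. Qed.
HB.instance Definition _ :=
  GRing.isLinear.Build A (U * U)%type U _ codiag codiag_linear.
End Diagonals.

Lemma dsum_exact (Z1 X1 Z2 X2 : fgmod A)
    (E1 : extension Z1 X1) (E2 : extension Z2 X2) :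
  short_exact (prod_map (incl E1) (incl E2)) (prod_map (prj E1) (prj E2)).
Proof.
case: (ext_exact E1) (ext_exact E2) => [i1 e1 s1] [i2 e2 s2]; split.
- by case=> x y [x' y'] [/i1-> /i2->].
- case=> y1 y2; split.
    by case=> /e1[x1 <-] /e2[x2 <-]; exists (x1, x2).
  case=> -[x1 x2] [<- <-]; congr pair; rewrite /=.
    by apply/e1; exists x1.
  by apply/e2; exists x2.
- case=> z1 z2; have [y1 <-] := s1 z1; have [y2 <-] := s2 z2.
  by exists (y1, y2).
Qed.

Definition dsum (Z1 X1 Z2 X2 : fgmod A)
    (E1 : extension Z1 X1) (E2 : extension Z2 X2) :
    extension (prod_fgmod Z1 Z2) (prod_fgmod X1 X2) :=
  @Extension (prod_fgmod Z1 Z2) (prod_fgmod X1 X2)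
    (prod_fgmod (mid E1) (mid E2)) _ _ (dsum_exact E1 E2).

(* [E] represents the Baer sum: codiag (E1 + E2) diag. *)
Definition baer_sum (Z X : fgmod A) (E1 E2 E : extension Z X) : Prop :=
  exists E' : extension (prod_fgmod Z Z) X,
    @pushout _ (prod_fgmod X X) X (@codiag X) (dsum E1 E2) E' /\
    @pullback Z (prod_fgmod Z Z) X (@diag Z) E' E.

Definition ext_class := forall Z X : fgmod A, extension Z X -> Prop.

(* Closure under negation, the action of -1, follows from [asf_pushout]. *)
Record additive_subfunctor (F : ext_class) : Prop := {
  asf_equiv : forall Z X (E E' : extension Z X),
    equivalent E E' -> F Z X E -> F Z X E';
  asf_pushout : forall (Z X X' : fgmod A) (a : {linear X -> X'})
      (E : extension Z X) (E' : extension Z X'),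
    pushout a E E' -> F Z X E -> F Z X' E';
  asf_pullback : forall (Z' Z X : fgmod A) (c : {linear Z' -> Z})
      (E : extension Z X) (E' : extension Z' X),
    pullback c E E' -> F Z X E -> F Z' X E';
  asf_zero : forall Z X (E : extension Z X), split_ext E -> F Z X E;
  asf_add : forall Z X (E1 E2 E : extension Z X),
    baer_sum E1 E2 E -> F Z X E1 -> F Z X E2 -> F Z X E }.

Definition nonzero_class (F : ext_class) : Prop :=
  exists Z X (E : extension Z X), F Z X E /\ ~ split_ext E.

Section Relative.
Variable F : ext_class.

Definition F_exact (X Y Z : fgmod A)
    (f : {linear X -> Y}) (g : {linear Y -> Z}) : Prop :=
  exists e : short_exact f g, F (Extension e).

Definition F_mono (X Y : fgmod A) (f : {linear X -> Y}) : Prop :=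
  exists (Z : fgmod A) (g : {linear Y -> Z}), F_exact f g.

Definition F_epi (Y Z : fgmod A) (g : {linear Y -> Z}) : Prop :=
  exists (X : fgmod A) (f : {linear X -> Y}), F_exact f g.

Definition F_projective (P : fgmod A) : Prop :=
  forall (X Y Z : fgmod A) (f : {linear X -> Y}) (g : {linear Y -> Z}),
    F_exact f g ->
    short_exact (fun h : hom P X => hcomp f h) (fun h : hom P Y => hcomp g h).

Definition F_injective (I : fgmod A) : Prop :=
  forall (X Y Z : fgmod A) (f : {linear X -> Y}) (g : {linear Y -> Z}),
    F_exact f g ->
    short_exact (fun h : hom Z I => hcomp h g) (fun h : hom Y I => hcomp h f).

Definition enough_projectives : Prop :=
  forall M : fgmod A, exists (P : fgmod A) (g : {linear P -> M}),
    F_projective P /\ F_epi g.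

Definition enough_injectives : Prop :=
  forall M : fgmod A, exists (I : fgmod A) (f : {linear M -> I}),
    F_injective I /\ F_mono f.

End Relative.
End Extensions.

(* Only used for objects that exist and are unique up to isomorphism (or
   homotopy) once F has enough projectives: resolutions and syzygies. *)
Definition choose (T : Type) (t0 : T) (P : T -> Prop) : T :=
  if pselect (exists x, P x) is left ex then projT1 (cid ex) else t0.

Section RelativeExt.
Variables (A : pzRingType) (F : ext_class A).

Record augmented (X : fgmod A) := Augmented {
  term : nat -> fgmod A;
  diff : forall n, {linear term n.+1 -> term n};
  augm : {linear term 0%N -> X} }.

(* [K n] is the image of [diff n]; F-exactness of the resolution means that the
   short exact sequences it splits into are F-exact. *)
Definition is_F_resolution (X : fgmod A) (r : augmented X) : Prop :=
  (forall n, F_projective F (term r n)) /\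
  exists (K : nat -> fgmod A)
         (i : forall n, {linear K n -> term r n})
         (q : forall n, {linear term r n.+1 -> K n}),
    [/\ forall n x, diff r n x = i n (q n x),
        F_exact F (i 0%N) (augm r)
      & forall n, F_exact F (i n.+1) (q n)].

Definition junk_augmented (X : fgmod A) : augmented X :=
  Augmented (term := fun=> X) (fun=> \0) \0.

Definition F_resolution (X : fgmod A) : augmented X :=
  choose (junk_augmented X) (@is_F_resolution X).

Section Ext.
Variables (i : nat) (X N : fgmod A).
Let P := term (F_resolution X).

Definition cocycles : {pred hom (P i) N} :=
  fun f => `[< hcomp f (diff (F_resolution X) i) = 0 >].

Lemma cocycles_zmod : zmod_closed cocycles.
Proof.
split=> [|f g]; first by apply/asboolP/hom_ext.
move=> /asboolP hf /asboolP hg; apply/asboolP/hom_ext => x /=.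
have := congr1 (fun h : hom _ _ => h x) hf.
have := congr1 (fun h : hom _ _ => h x) hg.
by rewrite /= => -> ->; rewrite subr0.
Qed.
HB.instance Definition _ :=
  GRing.isZmodClosed.Build (hom (P i) N) cocycles cocycles_zmod.

Record cocycle := Cocycle {
  cocycle_val :> hom (P i) N;
  cocycleP : cocycle_val \in cocycles }.
HB.instance Definition _ := [isSub for cocycle_val].
HB.instance Definition _ := [Choice of cocycle by <:].
HB.instance Definition _ := [SubChoice_isSubZmodule of cocycle by <:].

Definition is_coboundary (j : nat) : hom (term (F_resolution X) j) N -> Prop :=
  match j with
  | 0%N => fun f => f = 0
  | k.+1 => fun f => exists g : hom (term (F_resolution X) k) N,
              f = hcomp g (diff (F_resolution X) k)
  end.

Definition coboundaries : {pred cocycle} :=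
  fun f => `[< is_coboundary (cocycle_val f) >].

Lemma coboundaries_zmod : zmod_closed coboundaries.
Proof.
suff H j : is_coboundary (0 : hom (term (F_resolution X) j) N) /\
    forall f g : hom (term (F_resolution X) j) N,
      is_coboundary f -> is_coboundary g -> is_coboundary (f - g).
  have [H0 HB] := H i; split=> [|f g]; first exact/asboolP.
  by move=> /asboolP hf /asboolP hg; apply/asboolP; exact: HB.
case: j => [|j] /=; split.
- by [].
- by move=> f g -> ->; rewrite subr0.
- by exists 0; apply: hom_ext.
- by move=> f g [f' ->] [g' ->]; exists (f' - g'); apply: hom_ext.
Qed.
HB.instance Definition _ :=
  GRing.isZmodClosed.Build cocycle coboundaries coboundaries_zmod.

Definition Ext : zmodType := Quotient.quot coboundaries.

End Ext.

Lemma cocycle_post (i : nat) (X N N' : fgmod A) (h : {linear N -> N'})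
  (z : cocycle i X N) : hcomp h (cocycle_val z) \in @cocycles i X N'.
Proof.
case: z => z /= /asboolP hz; apply/asboolP/hom_ext => x /=.
have /= -> := congr1 (fun h : hom _ _ => h x) hz.
exact: raddf0.
Qed.

Definition Ext_map (i : nat) (X N N' : fgmod A) (h : {linear N -> N'})
    (x : Ext i X N) : Ext i X N' :=
  \pi_(Ext i X N') (Cocycle (cocycle_post h (repr x))).

Definition Ext_iso (i : nat) (X Y : fgmod A) : Prop :=
  exists theta : forall N : fgmod A, Ext i X N -> Ext i Y N,
    [/\ forall N, {morph theta N : x y / x + y},
        forall N, bijective (theta N)
      & forall (N N' : fgmod A) (h : {linear N -> N'}) (x : Ext i X N),
          theta N' (Ext_map h x) = Ext_map h (theta N x)].

Definition relative_division (d : nat) (M X Y : fgmod A) : Prop :=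
  [/\ in_add M X /\ in_add M Y,
      forall Z : fgmod A, in_add X Z -> in_add Y Z -> is_zero Z,
      ~ Ext_iso d X Y
    & Ext_iso d.+1 X Y].

End RelativeExt.

Section IgusaTodorov.
Variables (A : pzRingType) (F : ext_class A).

(* A cover is a right minimal F-epimorphism from an F-projective module. *)
Definition F_projective_cover (P M : fgmod A) (g : {linear P -> M}) : Prop :=
  [/\ F_projective F P, F_epi F g &
      forall h : {linear P -> P}, (forall x, g (h x) = g x) -> bijective h].

Definition is_syzygy (M K : fgmod A) : Prop :=
  exists (P : fgmod A) (f : {linear K -> P}) (g : {linear P -> M}),
    F_projective_cover g /\ short_exact f g.

Definition Omega (M : fgmod A) : fgmod A := choose M (is_syzygy M).

(* K_F(A) by generators and relations: formal expressions modulo [K_eq].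
   It is kept as a setoid since [fgmod A] lives in a universe too large for
   the carrier of a zmodType.  Isomorphic modules
   have equal classes by [K_sum] with Y = 0. *)
Inductive K_expr : Type :=
  | K_zero
  | K_gen of fgmod A
  | K_add of K_expr & K_expr
  | K_opp of K_expr.

Inductive K_eq : K_expr -> K_expr -> Prop :=
  | K_refl x : K_eq x x
  | K_sym x y : K_eq x y -> K_eq y x
  | K_trans x y z : K_eq x y -> K_eq y z -> K_eq x z
  | K_addE x x' y y' : K_eq x x' -> K_eq y y' -> K_eq (K_add x y) (K_add x' y')
  | K_oppE x x' : K_eq x x' -> K_eq (K_opp x) (K_opp x')
  | K_addA x y z : K_eq (K_add x (K_add y z)) (K_add (K_add x y) z)
  | K_addC x y : K_eq (K_add x y) (K_add y x)
  | K_add0 x : K_eq (K_add K_zero x) x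
  | K_addN x : K_eq (K_add (K_opp x) x) K_zero
  | K_sum (N X Y : fgmod A) : liso N (X * Y)%type ->
      K_eq (K_gen N) (K_add (K_gen X) (K_gen Y))
  | K_proj (P : fgmod A) : F_projective F P -> K_eq (K_gen P) K_zero.

Fixpoint K_Omega (x : K_expr) : K_expr :=
  match x with
  | K_zero => K_zero
  | K_gen M => K_gen (Omega M)
  | K_add x y => K_add (K_Omega x) (K_Omega y)
  | K_opp x => K_opp (K_Omega x)
  end.

Inductive K_span (M : fgmod A) : K_expr -> Prop :=
  | K_span_gen (N : fgmod A) : indecomposable N -> ~ F_projective F N ->
      is_summand N M -> K_span M (K_gen N)
  | K_span0 : K_span M K_zero
  | K_spanD x y : K_span M x -> K_span M y -> K_span M (K_add x y)
  | K_spanN x : K_span M x -> K_span M (K_opp x)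
  | K_span_eq x y : K_eq x y -> K_span M x -> K_span M y.

Definition Omega_span (M : fgmod A) (m : nat) : K_expr -> Prop :=
  fun x => exists2 y, K_span M y & K_eq (iter m K_Omega y) x.

Definition Omega_span_iso (M : fgmod A) (m : nat) : Prop :=
  [/\ forall x, Omega_span M m x -> Omega_span M m.+1 (K_Omega x),
      forall x y, Omega_span M m x -> Omega_span M m y ->
        K_eq (K_Omega x) (K_Omega y) -> K_eq x y
    & forall y, Omega_span M m.+1 y ->
        exists2 x, Omega_span M m x & K_eq (K_Omega x) y].

Definition phi_dim_is (M : fgmod A) (k : nat) : Prop :=
  let stable j := forall m, (j <= m)%N -> Omega_span_iso M m in
  stable k /\ forall j, stable j -> (k <= j)%N.

End IgusaTodorov.

Definition is_max (S : set nat) (k : nat) : Prop :=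
  S k /\ forall d, S d -> (d <= k)%N.

(* Main.v *)
Require Import Defs.
From HB Require Import structures.
From mathcomp Require Import all_boot all_order all_algebra.
From mathcomp Require Import boolp classical_sets.

(** Work in the stable category: modules, with maps taken up to those that factor
through an [F]-projective module. Let [0 -> K -> P -> Z -> 0] be the step of
degree [d] of a relative projective resolution of [X], so that [Z] is the [d]-th
syzygy of [X]. Then [Ext^(d+1)(X, N)] is the cokernel of
[Hom(P, N) -> Hom(K, N)], and by Yoneda an isomorphism of
[Ext^(d+1)(X, -)] with [Ext^(d+1)(Y, -)] is a homotopy equivalence between such
steps, that is, a stable isomorphism between the [d]-th syzygies of [X] and [Y]
([Ext_iso_homotopic]).

Over an Artin algebra, Fitting's lemma holds and endomorphism rings of
indecomposable modules are local, so that finitely generated modules cancel from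
direct sums. Hence the Grothendieck group is the group of differences of a
cancellative monoid, and two modules have the same class exactly when they are
stably isomorphic ([K_genP]). The syzygy is a functor on the stable category
(relative Schanuel lemma, [stable_syzygy]), so [Omega] is well defined on the
group, and [Ext_iso_K_eq] results: [Ext^(d+1)(X, -)] and [Ext^(d+1)(Y, -)] are
isomorphic if and only if [Omega^d [X] = Omega^d [Y]].

Since [Omega] maps [Omega^m <M>] onto [Omega^(m+1) <M>], the number [phi-dim M]
is the first degree from which on the kernels of [<M> -> Omega^m <M>] are
constant. By Krull-Schmidt, [<M>] is generated by finitely many classes [[N_i]],
so these kernels come from an ascending chain of subgroups of some [Z^n], and
the chain stops. A jump of the kernel from [Omega^(d-1)] to [Omega^d] is an
element [[X] - [Y]] with [X] and [Y] in [add M], and cancelling the common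
summands makes [add X] and [add Y] meet in zero; by [Ext_iso_K_eq] such an
element is the same thing as a [d]-division. The largest [d] with a [d]-division
is thus the last degree in which the kernel jumps. *)

Set Implicit Arguments.
Unset Strict Implicit.
Unset Printing Implicit Defensive.

Import Order.TTheory GRing.Theory Num.Theory.
Local Open Scope ring_scope.

(** * Linear maps, kernels and direct summands *)

Definition lin (A : pzRingType) (U V : lmodType A) (f : U -> V)
    (fL : linear f) : {linear U -> V} :=
  HB.pack f (GRing.isLinear.Build A U V _ f fL).

Section Kernel.
Variables (A : pzRingType) (U V : lmodType A) (f : {linear U -> V}).

Definition ker_pred : {pred U} := fun u => f u == 0.

Lemma ker_pred_closed : subsemimod_closed ker_pred.
Proof.
split; first split.
- by apply/eqP; rewrite linear0.
- by move=> u v /eqP fu /eqP fv; apply/eqP; rewrite linearD fu fv addr0.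
- by move=> a u /eqP fu; apply/eqP; rewrite linearZ /= fu scaler0.
Qed.

HB.instance Definition _ :=
  GRing.isSubmodClosed.Build A U ker_pred ker_pred_closed.

Record ker := Ker { ker_val :> U; ker_valP : ker_val \in ker_pred }.
HB.instance Definition _ := [isSub for ker_val].
HB.instance Definition _ := [Choice of ker by <:].
HB.instance Definition _ := [SubChoice_isSubLmodule of ker by <:].

Definition ker_incl : {linear ker -> U} := (val : ker -> U).

Lemma ker_inclP (x : ker) : f (ker_incl x) = 0.
Proof. exact/eqP/(ker_valP x). Qed.

Lemma ker_incl_inj : injective ker_incl.
Proof. exact: val_inj. Qed.

Lemma ker_incl_ex u : f u = 0 -> exists x : ker, ker_incl x = u.
Proof. by move/eqP=> fu; exists (Ker fu). Qed.

End Kernel.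

Section Linear.
Variable A : pzRingType.
Implicit Types U V W : lmodType A.

Lemma lift_mono U V W (i : {linear U -> V}) (h : {linear W -> V}) :
  injective i -> (forall w, exists u, i u = h w) ->
  exists a : {linear W -> U}, forall w, i (a w) = h w.
Proof.
move=> i_inj ih; pose a w := projT1 (cid (ih w)).
have aP w : i (a w) = h w by rewrite /a; case: cid.
have aL : linear a by move=> c x y; apply: i_inj; rewrite linearP !aP linearP.
by exists (lin aL).
Qed.

Lemma factor_epi U V W (q : {linear U -> V}) (h : {linear U -> W}) :
  (forall v, exists u, q u = v) -> (forall u, q u = 0 -> h u = 0) ->
  exists a : {linear V -> W}, forall u, a (q u) = h u.
Proof.
move=> q_surj qh; pose s v := projT1 (cid (q_surj v)).
have sP v : q (s v) = v by rewrite /s; case: cid.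
have aP u : h (s (q u)) = h u.
  by apply/subr0_eq; rewrite -linearB; apply: qh; rewrite linearB sP subrr.
have aL : linear (h \o s).
  move=> c x y /=; rewrite -[x in RHS]sP -[y in RHS]sP !aP -linearP.
  by rewrite -[RHS]aP linearP !sP.
by exists (lin aL).
Qed.

Lemma inv_linear U V (f : {linear U -> V}) : bijective f ->
  exists g : {linear V -> U}, cancel f g /\ cancel g f.
Proof.
move=> [g fK gK].
have gL : linear g by move=> c x y; apply: (can_inj fK); rewrite linearP !gK.
by exists (lin gL).
Qed.

Lemma inj_surj_bij (T T' : Type) (f : T -> T') :
  injective f -> (forall y, exists x, f x = y) -> bijective f.
Proof.
move=> fI fS; exists (fun y => projT1 (cid (fS y))) => [x|y].
  by apply: fI; case: cid.
by case: cid.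
Qed.

Lemma finitely_generated_surj U V (q : {linear U -> V}) :
  (forall v, exists u, q u = v) -> finitely_generated U ->
  finitely_generated V.
Proof.
move=> q_surj [n [e he]]; exists n, (q \o e) => v.
have [u <-] := q_surj v; have [c ->] := he u; exists c.
by rewrite linear_sum; apply: eq_bigr => i _; rewrite linearZ.
Qed.

Lemma inl_linear U V : linear (fun u : U => (u, 0) : U * V).
Proof. by move=> a x y; congr pair; rewrite /= scaler0 addr0. Qed.

Lemma inr_linear U V : linear (fun v : V => (0, v) : U * V).
Proof. by move=> a x y; congr pair; rewrite /= scaler0 addr0. Qed.

Lemma outl_linear U V : linear (fun p : U * V => p.1).
Proof. by []. Qed.

Lemma outr_linear U V : linear (fun p : U * V => p.2).
Proof. by []. Qed.

Definition inL U V : {linear U -> (U * V)%type} := lin (@inl_linear U V).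
Definition inR U V : {linear V -> (U * V)%type} := lin (@inr_linear U V).
Definition outL U V : {linear (U * V)%type -> U} := lin (@outl_linear U V).
Definition outR U V : {linear (U * V)%type -> V} := lin (@outr_linear U V).

Lemma prod_split U V (p : U * V) : p = inL U V p.1 + inR U V p.2.
Proof. by case: p => x y; congr pair; rewrite /= ?addr0 ?add0r. Qed.

Lemma liso_refl U : liso U U.
Proof. by exists idfun; exists id. Qed.

Lemma liso_sym U V : liso U V -> liso V U.
Proof.
by move=> [f /inv_linear[g [fK gK]]]; exists g; exists f.
Qed.

Lemma liso_trans V U W : liso U V -> liso V W -> liso U W.
Proof. by move=> [f fB] [g gB]; exists (g \o f); exact: bij_comp. Qed.

Lemma is_zero_liso U V : liso U V -> is_zero U -> is_zero V.
Proof.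
by move=> /liso_sym[f [g fK _]] U0 v; apply: (can_inj fK); rewrite !(U0 (f _)).
Qed.

Lemma liso_prod U U' V V' :
  liso U U' -> liso V V' -> liso (U * V)%type (U' * V')%type.
Proof.
move=> [f [f' fK f'K]] [g [g' gK g'K]].
exists (prod_map f g : {linear (U * V)%type -> (U' * V')%type}).
exists (fun p => (f' p.1, g' p.2)); case=> x y.
  by congr pair; rewrite /= ?fK ?gK.
by congr pair; rewrite /= ?f'K ?g'K.
Qed.

Lemma liso_prodC U V : liso (U * V)%type (V * U)%type.
Proof.
have sL : linear (fun p : U * V => (p.2, p.1)) by [].
by exists (lin sL); exists (fun p => (p.2, p.1)); case.
Qed.

Lemma liso_prodA U V W : liso (U * (V * W))%type ((U * V) * W)%type.
Proof.
have sL : linear (fun p : U * (V * W) => ((p.1, p.2.1), p.2.2)) by [].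
exists (lin sL); exists (fun p => (p.1.1, (p.1.2, p.2))).
  by case=> x [].
by case=> -[].
Qed.

Lemma liso_prodACA U V U' V' :
  liso ((U * V) * (U' * V'))%type ((U * U') * (V * V'))%type.
Proof.
have sL : linear (fun p : (U * V) * (U' * V') =>
    ((p.1.1, p.2.1), (p.1.2, p.2.2))) by [].
exists (lin sL); exists (fun p => ((p.1.1, p.2.1), (p.1.2, p.2.2))).
  by case=> -[] ? ? [].
by case=> -[] ? ? [].
Qed.

Lemma liso_prod0 U V : is_zero V -> liso (U * V)%type U.
Proof.
move=> V0; exists (outL U V); exists (fun u => (u, 0)) => //.
by case=> u v; rewrite (V0 v).
Qed.

Lemma pair_liso U V W (i : {linear V -> U}) (p : {linear U -> V})
    (j : {linear W -> U}) (q : {linear U -> W}) :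
  cancel i p -> cancel j q -> (forall u, i (p u) + j (q u) = u) ->
  liso U (V * W)%type.
Proof.
move=> pi qj sum1.
have pj w : p (j w) = 0.
  have := sum1 (j w); rewrite qj -[RHS]add0r => /addIr ipj.
  by rewrite -[LHS]pi ipj !linear0.
have qi v : q (i v) = 0.
  have := sum1 (i v); rewrite pi -[RHS]addr0 => /addrI jqi.
  by rewrite -[LHS]qj jqi !linear0.
have fL : linear (fun u => (p u, q u)) by move=> a x y; rewrite !linearP.
exists (lin fL); exists (fun x => i x.1 + j x.2) => [u|]; first exact: sum1.
case=> v w /=.
by rewrite !linearD pi qj pj qi addr0 add0r.
Qed.

End Linear.

Section Summands.
Variable A : pzRingType.
Implicit Types M N X Y : fgmod A.

(** The image of [e] is taken as the kernel of [1 - e], so that kernels are the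
only submodules ever turned into modules. *)
Lemma split_idempotent M (e : {linear M -> M}) :
  (forall u, e (e u) = e u) ->
  exists (X : fgmod A) (i : {linear X -> M}) (p : {linear M -> X}),
    cancel i p /\ forall u, i (p u) = e u.
Proof.
move=> eK.
have dL : linear (fun u => u - e u).
  move=> a x y; rewrite linearP scalerBr opprD.
  by rewrite addrACA.
pose i : {linear ker (lin dL) -> M} := ker_incl (lin dL).
have [p pP] : exists p : {linear M -> ker (lin dL)}, forall u, i (p u) = e u.
  apply: lift_mono; first exact: ker_incl_inj.
  by move=> u; apply: ker_incl_ex; rewrite /= eK subrr.
have pi : cancel i p.
  move=> x; apply: (@ker_incl_inj _ _ _ (lin dL)); rewrite [LHS]pP.
  by have /subr0_eq <- := ker_inclP x.
have fg : finitely_generated (ker (lin dL)).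
  apply: (@finitely_generated_surj _ _ _ p) (fgmodP M) => x.
  by exists (i x).
by exists (FGMod fg), i, p.
Qed.

Definition retract X M :=
  exists (i : {linear X -> M}) (p : {linear M -> X}), cancel i p.

Lemma split_mono X M (i : {linear X -> M}) (p : {linear M -> X}) :
  cancel i p ->
  exists (L : fgmod A) (j : {linear L -> M}) (q : {linear M -> L}),
    cancel j q /\ forall u, i (p u) + j (q u) = u.
Proof.
move=> pi; have eL : linear (fun u => u - i (p u)).
  by move=> a x y; rewrite (linearP p) (linearP i) scalerBr opprD addrACA.
have eK : forall u, lin eL (lin eL u) = lin eL u.
  by move=> u /=; rewrite linearB pi subrr linear0 subr0.
have [L [j [q [qj jq]]]] := split_idempotent eK.
exists L, j, q; split=> // u; rewrite jq /=.
by rewrite addrC subrK.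
Qed.

Lemma retract_summand X M : retract X M <-> is_summand X M.
Proof.
split=> [[i [p pi]]|[L [f fB]]].
  have [L [j [q [qj sum1]]]] := split_mono pi.
  by exists L; exact: (pair_liso pi qj sum1).
have [g [fK gK]] := inv_linear fB.
exists (g \o inL X L), (outL X L \o f) => x /=.
by rewrite gK.
Qed.

Lemma retract_trans Y X Z : retract X Y -> retract Y Z -> retract X Z.
Proof.
move=> [i [p pi]] [j [q qj]]; exists (j \o i), (p \o q).
by move=> x /=; rewrite qj pi.
Qed.

Lemma liso_retract X Y : liso X Y -> retract X Y.
Proof. by move=> [f /inv_linear[g [fK _]]]; exists f, g. Qed.

Lemma indecomposable_retract X M :
  indecomposable M -> ~ is_zero X -> retract X M -> liso X M.
Proof.
move=> [_ Mi] X0 /retract_summand[L /[dup] ML /Mi[//|L0]].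
by apply: liso_sym; apply: liso_trans ML _; exact: liso_prod0.
Qed.

Lemma fgmod0_ex : exists Z : fgmod A, is_zero Z.
Proof.
have Z0 : is_zero 'rV[A]_0 by move=> v; apply/matrixP => i [].
have fg : finitely_generated 'rV[A]_0.
  exists 0%N, (fun=> 0) => v; exists (fun=> 0); by rewrite big_ord0 (Z0 v).
by exists (FGMod fg).
Qed.

Definition fgmod0 : fgmod A := projT1 (cid fgmod0_ex).

Lemma fgmod0P : is_zero fgmod0.
Proof. by rewrite /fgmod0; case: cid. Qed.

End Summands.

(** * Maps factoring through a class of modules *)

Section Through.
Variables (A : pzRingType) (C : fgmod A -> Prop).
Implicit Types X Y Z : fgmod A.

(** The ideal of the module category generated by the identities of the modules
in [C]; membership of [id] in such ideals expresses at once projectivity,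
membership in [add M], and isomorphism in the stable category. *)
Inductive through X Y : {linear X -> Y} -> Prop :=
| through0 (h : {linear X -> Y}) : (forall x, h x = 0) -> through h
| throughD (h h' : {linear X -> Y}) (N : fgmod A)
    (s : {linear X -> N}) (r : {linear N -> Y}) :
    C N -> through h' -> (forall x, h x = r (s x) + h' x) -> through h.

Lemma through_add X Y (h h1 h2 : {linear X -> Y}) :
  through h1 -> through h2 -> (forall x, h x = h1 x + h2 x) -> through h.
Proof.
move=> th1 th2; elim: th1 h => {h1}[h1 h10|h1 h' N s r CN _ IH h1E] h hE.
  elim: th2 h hE => {h2}[h2 h20|h2 h' N s r CN th' _ h2E] h hE.
    by apply: through0 => x; rewrite hE h10 h20 addr0.
  by apply: (throughD CN th') => x; rewrite hE h10 add0r.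
have hT : through (h' \+ h2 : {linear X -> Y}) by exact: IH.
apply: (throughD CN hT) => x.
by rewrite hE h1E /= addrA.
Qed.

Lemma through_comp X' X Y Y' (g : {linear X' -> X}) (h : {linear X -> Y})
    (f : {linear Y -> Y'}) (k : {linear X' -> Y'}) :
  through h -> (forall x, k x = f (h (g x))) -> through k.
Proof.
move=> th; elim: th k => {h}[h h0|h h' N s r CN _ IH hE] k kE.
  by apply: through0 => x; rewrite kE h0 linear0.
apply: (@throughD _ _ k (f \o h' \o g) N (s \o g) (f \o r) CN).
  exact: IH.
by move=> x; rewrite kE hE linearD.
Qed.

Lemma through1 X Y (N : fgmod A) (s : {linear X -> N}) (r : {linear N -> Y})
    (h : {linear X -> Y}) : C N -> (forall x, h x = r (s x)) -> through h.
Proof.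
move=> CN hE; have h0 : through (\0 : {linear X -> Y}) by exact: through0.
apply: (throughD CN h0) => x.
by rewrite hE addr0.
Qed.

Lemma through_sum (I : Type) (s : seq I) X Y (f : I -> {linear X -> Y})
    (h : {linear X -> Y}) :
  (forall i, through (f i)) -> (forall x, h x = \sum_(i <- s) f i x) ->
  through h.
Proof.
move=> tf; elim: s h => [|i s IH] h hE.
  by apply: through0 => x; rewrite hE big_nil.
have sL : linear (fun x => \sum_(i <- s) f i x).
  move=> a x y; rewrite scaler_sumr -big_split /=.
  by apply: eq_bigr => j _; rewrite linearP.
have hT : through (lin sL) by exact: IH.
apply: (through_add (tf i) hT) => x.
by rewrite hE big_cons.
Qed.

Lemma through_id_comp X Y Z (g : {linear X -> Y}) (f : {linear Y -> Z})
    (k : {linear X -> Z}) :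
  through (idfun : {linear Y -> Y}) -> (forall x, k x = f (g x)) -> through k.
Proof. by move=> tY kE; apply: (through_comp (g := g) (f := f) tY). Qed.

Lemma through_id_retract X Y : retract X Y ->
  through (idfun : {linear Y -> Y}) -> through (idfun : {linear X -> X}).
Proof.
by move=> [i [p pi]] tY; apply: (through_id_comp (g := i) (f := p) tY) => x.
Qed.

Lemma through_id_prod X Y : through (idfun : {linear X -> X}) ->
  through (idfun : {linear Y -> Y}) ->
  through (idfun : {linear prod_fgmod X Y -> prod_fgmod X Y}).
Proof.
move=> tX tY.
pose P := prod_fgmod X Y.
have tl : through (inL X Y \o outL X Y : {linear P -> P}).
  exact: (@through_id_comp P X P (outL X Y) (inL X Y) _ tX).
have tr : through (inR X Y \o outR X Y : {linear P -> P}).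
  exact: (@through_id_comp P Y P (outR X Y) (inR X Y) _ tY).
apply: (through_add tl tr) => p; exact: prod_split.
Qed.

End Through.

Lemma through_sub (A : pzRingType) (C C' : fgmod A -> Prop) (X Y : fgmod A)
    (h : {linear X -> Y}) :
  (forall N, C N -> through C' (idfun : {linear N -> N})) ->
  through C h -> through C' h.
Proof.
move=> CC'; elim=> {h}[h h0|h h' N s r CN _ IH hE]; first exact: through0.
apply: (through_add (h1 := r \o s) _ IH hE).
by apply: (through_id_comp (g := s) (f := r) (CC' _ CN)).
Qed.

Section Add.
Variables (A : pzRingType) (M : fgmod A).

Lemma ffun_succ_linear n (V : lmodType A) (W : lmodType A)
    (s0 : {linear V -> W}) (s : {linear V -> {ffun 'I_n -> W}}) :
  linear (fun x => [ffun i => if unlift ord0 i is Some j then s x j else s0 x]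
    : {ffun 'I_n.+1 -> W}).
Proof.
move=> a x y; apply/ffunP => i; rewrite !ffunE.
by case: unliftP => [j|] _; rewrite !linearP ?ffunE.
Qed.

Lemma ffun_fg n : finitely_generated {ffun 'I_n -> M}.
Proof.
elim: n => [|n IH].
  exists 0%N, (fun=> 0) => v; exists (fun=> 0); apply/ffunP; case=> //.
apply: (@finitely_generated_surj _ _ _
  (lin (ffun_succ_linear (outL M {ffun 'I_n -> M}) (outR M _)))).
  move=> v; exists (v ord0, [ffun j => v (lift ord0 j)]).
  apply/ffunP => i; rewrite !ffunE /=.
  by case: unliftP => [j|] ->; rewrite ?ffunE.
exact: prod_fg (fgmodP M) IH.
Qed.

Lemma through_ffun (X Y : fgmod A) (h : {linear X -> Y}) : through (eq M) h ->
  exists n (s : {linear X -> {ffun 'I_n -> M}})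
    (r : {linear {ffun 'I_n -> M} -> Y}), forall x, r (s x) = h x.
Proof.
elim=> {h}h; first by move=> h0; exists 0%N, \0, \0 => x; rewrite h0.
move=> h' N' s r MN _ [n [s' [r' rs']]] hE.
case: N' / MN s r hE => s r hE.
have rL : linear (fun v : {ffun 'I_n.+1 -> M} =>
    r (v ord0) + r' [ffun j => v (lift ord0 j)]).
  move=> a x y; rewrite scalerDr addrACA -!linearZ -!linearD.
  rewrite !ffunE; congr (_ + r' _).
  by apply/ffunP => j; rewrite !ffunE.
exists n.+1, (lin (ffun_succ_linear s s')), (lin rL) => x /=.
rewrite hE ffunE unlift_none -rs'; congr (_ + r' _).
by apply/ffunP => j; rewrite !ffunE liftK.
Qed.

(** [N] is a summand of [M ^ n] exactly when its identity is a sum of [n] maps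
[N -> M -> N], the components of the section and of the retraction. *)
Lemma in_add_through N :
  in_add M N <-> through (eq M) (idfun : {linear N -> N}).
Proof.
split=> [[n [L NL]]|tN].
  have NS : is_summand N (FGMod (ffun_fg n)) by exists L.
  have [i [p pi]] := (retract_summand _ _).2 NS.
  have eL k : linear (fun v : {ffun 'I_n -> M} => v k).
    by move=> a x y; rewrite !ffunE.
  have dL k : linear (fun m : M => [ffun l => m *+ (l == k)] : {ffun 'I_n -> M}).
    move=> a x y; apply/ffunP => l; rewrite !ffunE.
    by case: eqP; rewrite ?mulr1n ?mulr0n ?scaler0 ?addr0.
  apply: (through_sum (f := fun k => p \o lin (dL k) \o (lin (eL k) \o i))
                      (s := index_enum _)).
    by move=> k; exact: (through1 (s := lin (eL k) \o i) (r := p \o lin (dL k))).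
  move=> x /=; rewrite -linear_sum -[LHS]pi; congr (p _).
  apply/ffunP => l; rewrite sum_ffunE (bigD1 l) //= !ffunE eqxx mulr1n.
  by rewrite big1 ?addr0 // => k /negPf kl; rewrite ffunE eq_sym kl.
have [n [s [r rs]]] := through_ffun tN.
have [L NL] : is_summand N (FGMod (ffun_fg n)).
  by apply/retract_summand; exists s, r.
by exists n, L.
Qed.

End Add.

(** * Chain conditions for row vectors *)

Section LeadingIdeals.
Variables (R : comNzRingType) (n : nat).
Implicit Types S T : set 'rV[R]_n.

Definition is_submodule S :=
  [/\ S 0, forall x y, S x -> S y -> S (x + y) & forall a x, S x -> S (a *: x)].

Definition leading S (i : 'I_n) : set R := fun r =>
  exists v, [/\ S v, forall j : 'I_n, (j < i)%N -> v 0 j = 0 & v 0 i = r].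

Lemma leading_ideal S i : is_submodule S -> is_ideal (leading S i).
Proof.
move=> [S0 SD SZ]; split.
- by exists 0; split=> [//|j _|]; rewrite mxE.
- move=> x y [u [Su u0 ux]] [v [Sv v0 vy]]; exists (u + v); split.
  + exact: SD.
  + by move=> j ji; rewrite mxE u0 // v0 // addr0.
  + by rewrite mxE ux vy.
- move=> a x [u [Su u0 ux]]; exists (a *: u); split.
  + exact: SZ.
  + by move=> j ji; rewrite mxE u0 // mulr0.
  + by rewrite mxE ux.
Qed.

Lemma leading_sub S T i : (S `<=` T)%classic ->
  (leading S i `<=` leading T i)%classic.
Proof. by move=> ST r [v [Sv v0 vr]]; exists v; split=> //; exact: ST. Qed.

(** Gaussian elimination: a vector of [T] can be reduced to zero by subtracting
vectors of [S] with the same leading entry. *)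
Lemma eq_leading S T : is_submodule S -> is_submodule T ->
  (S `<=` T)%classic -> (forall i, leading T i `<=` leading S i)%classic ->
  (T `<=` S)%classic.
Proof.
move=> [S0 SD SZ] [T0 TD TZ] ST lTS.
suff H k : forall v, T v -> (forall j : 'I_n, (j < n - k)%N -> v 0 j = 0) -> S v.
  by move=> v Tv; apply: (H n v Tv) => j; rewrite subnn.
elim: k => [|k IH] v Tv v0.
  suff -> : v = 0 by [].
  by apply/rowP => j; rewrite mxE v0 // subn0.
have [kn|nk] := ltnP k n; last first.
  by apply: IH => // j; have /eqP -> : (n - k)%N == 0%N by rewrite subn_eq0.
have in_n : (n - k.+1 < n)%N by rewrite ltn_subrL (leq_ltn_trans _ kn).
have [u [Su u0 uv]] : leading S (Ordinal in_n) (v 0 (Ordinal in_n)).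
  by apply: lTS; exists v.
rewrite -[v](subrK u); apply: (SD _ _ _ Su); apply: IH => [|j].
  by apply: TD => //; rewrite -scaleN1r; apply: TZ; exact: ST.
rewrite -(subnSK kn) ltnS leq_eqVlt !mxE => /orP[/eqP jE|jn].
  have -> : j = Ordinal in_n by exact: val_inj.
  by rewrite uv subrr.
by rewrite v0 // u0 // subrr.
Qed.

Definition stationary (T : Type) (I : nat -> set T) :=
  exists k, forall m, (k <= m)%N -> I m = I k.

Lemma mono_chain (T : Type) (I : nat -> set T) :
  (forall k, I k `<=` I k.+1)%classic ->
  forall k m, (k <= m)%N -> (I k `<=` I m)%classic.
Proof.
move=> II k m /subnKC <-; elim: (m - k)%N => [|d IH]; first by rewrite addn0.
by rewrite addnS => x /IH; exact: II.
Qed.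

Lemma anti_chain (T : Type) (I : nat -> set T) :
  (forall k, I k.+1 `<=` I k)%classic ->
  forall k m, (k <= m)%N -> (I m `<=` I k)%classic.
Proof.
move=> II k m /subnKC <-; elim: (m - k)%N => [|d IH]; first by rewrite addn0.
by rewrite addnS => x /II; exact: IH.
Qed.

Lemma common_stationary (S : nat -> set 'rV[R]_n) :
  (forall i, stationary (fun k => leading (S k) i)) ->
  exists k, forall i m, (k <= m)%N -> leading (S m) i = leading (S k) i.
Proof.
move=> st; pose K i := projT1 (cid (st i)).
have KP i m : (K i <= m)%N -> leading (S m) i = leading (S (K i)) i.
  by rewrite /K; case: cid => k /= kP; exact: kP.
exists (\max_i K i) => i m km.
have Ki : (K i <= \max_i K i)%N by exact: (leq_bigmax i).
by rewrite !KP // (leq_trans Ki).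
Qed.

Lemma row_dcc (S : nat -> set 'rV[R]_n) : artinian R ->
  (forall k, is_submodule (S k)) -> (forall k, S k.+1 `<=` S k)%classic ->
  stationary S.
Proof.
move=> Rart Ssub Sdec.
have [|k kP] := @common_stationary S.
  move=> i; apply: Rart => k; first exact: leading_ideal.
  exact: leading_sub.
exists k => m km; rewrite eqEsubset; split; first exact: anti_chain.
apply: eq_leading => //; first exact: anti_chain.
by move=> i; rewrite kP.
Qed.

Lemma row_acc (S : nat -> set 'rV[R]_n) :
  (forall I : nat -> set R, (forall k, is_ideal (I k)) ->
    (forall k, I k `<=` I k.+1)%classic -> stationary I) ->
  (forall k, is_submodule (S k)) -> (forall k, S k `<=` S k.+1)%classic ->
  stationary S.
Proof.
move=> Rnoeth Ssub Sinc.
have [|k kP] := @common_stationary S.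
  move=> i; apply: Rnoeth => k; first exact: leading_ideal.
  exact: leading_sub.
exists k => m km; rewrite eqEsubset; split; last exact: mono_chain.
apply: eq_leading => //; first exact: mono_chain.
by move=> i; rewrite kP.
Qed.

End LeadingIdeals.

(** Unless zero, the union of an ascending chain of ideals of [int] is generated by
its least positive element, which already lies in some member of the chain. *)
Lemma int_noetherian (I : nat -> set int) : (forall k, is_ideal (I k)) ->
  (forall k, I k `<=` I k.+1)%classic -> stationary I.
Proof.
move=> Iid Iinc.
have Iabs k x : I k x -> I k (Posz `|x|%N).
  case: x => // p Ip; rewrite (_ : Posz _ = -1 * Negz p).
    by have [_ _ IM] := Iid k; exact: IM.
  by rewrite mulN1r NegzE opprK.
have [[k0 [d [Id d0]]]|none] :=
    pselect (exists k (d : nat), I k (Posz d) /\ (0 < d)%N); last first.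
  exists 0%N => m _; rewrite eqEsubset.
  have I0 k x : I k x -> x = 0.
    move=> /Iabs Ix; apply/eqP; rewrite -absz_eq0 -leqn0 leqNgt.
    by apply/negP => x0; apply: none; exists k, `|x|%N.
  split=> x /I0 ->.
    by have [] := Iid 0%N.
  by have [] := Iid m.
have ex : exists d, `[< (0 < d)%N /\ exists k, I k (Posz d) >].
  by exists d; apply/asboolP; split=> //; exists k0.
have [g] := ex_minnP ex; move=> /asboolP[g0 [k Ig]] gmin.
exists k => m km; rewrite eqEsubset; split; last exact: mono_chain.
move=> x Ix.
suff /eqP x0 : (x %% Posz g)%Z == 0.
  rewrite (divz_eq x (Posz g)) x0 addr0.
  by have [_ _ IM] := Iid k; exact: IM.
have Igm : I m (Posz g) by exact: (mono_chain Iinc km).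
have Ir : I m (x %% Posz g)%Z.
  rewrite /modz -mulNr; have [_ ID IM] := Iid m.
  by apply: ID => //; exact: IM.
rewrite -absz_eq0 -leqn0 leqNgt; apply/negP => r0.
have /gmin gr : `[< (0 < `|(x %% Posz g)%Z|)%N /\
    exists k, I k (Posz `|(x %% Posz g)%Z|%N) >].
  by apply/asboolP; split=> //; exists m; exact: Iabs.
have rg : (x %% Posz g)%Z < Posz g by rewrite ltz_pmod.
have r_ge0 : 0 <= (x %% Posz g)%Z by rewrite modz_ge0 // -lt0n.
by move: rg; rewrite -(gez0_abs r_ge0) ltNge lez_nat gr.
Qed.

(** * Modules over an Artin algebra *)

Section Combination.
Variables (R : comNzRingType) (A : algType R) (n : nat).
Variables (U : lmodType A) (e : 'I_n -> U).

Definition comb (r : 'rV[R]_n) : U := \sum_i (r 0 i)%:A *: e i.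

Lemma comb0 : comb 0 = 0.
Proof. by rewrite /comb big1 // => i _; rewrite mxE !scale0r. Qed.

Lemma combD x y : comb (x + y) = comb x + comb y.
Proof.
by rewrite /comb -big_split; apply: eq_bigr => i _; rewrite mxE !scalerDl.
Qed.

Lemma combZ a x : comb (a *: x) = a%:A *: comb x.
Proof.
rewrite /comb scaler_sumr; apply: eq_bigr => i _.
by rewrite mxE [in RHS]scalerA -scalerAl mul1r scalerA.
Qed.

Lemma comb_sum (I : Type) (s : seq I) (P : pred I) (f : I -> 'rV[R]_n) :
  comb (\sum_(i <- s | P i) f i) = \sum_(i <- s | P i) comb (f i).
Proof. exact: (big_morph comb combD comb0). Qed.

End Combination.

(** If [h] maps [C e] to [e], then [h ^ k] maps [r C ^ k e] to [r e]. When
[h (r e) = 0], applying [h ^ n] to the Cayley-Hamilton relation of [C] therefore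
kills every term except the leading one, which is [r e]. *)
Lemma comb_injective (R : comNzRingType) (A : algType R) n (U : lmodType A)
    (e : 'I_n -> U) (C : 'M[R]_n) (h : {linear U -> U}) (r : 'rV[R]_n) :
  (forall i, h (comb e (row i C)) = e i) -> h (comb e r) = 0 -> comb e r = 0.
Proof.
case: n e C r => [|m] e C r hC hr0; first by rewrite /comb big_ord0.
have hcomb x : h (comb e (x *m C)) = comb e x.
  rewrite mulmx_sum_row comb_sum linear_sum [RHS]/comb; apply: eq_bigr => i _.
  by rewrite combZ linearZ /= hC.
have hpow k x : iter k h (comb e (x *m C ^+ k)) = comb e x.
  elim: k x => [|k IH] x; first by rewrite mulmx1.
  by rewrite iterSr exprSr mulmxA hcomb.
have iter0 k : iter k h 0 = 0 by elim: k => //= k ->; rewrite linear0.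
have itD k x y : iter k h (x + y) = iter k h x + iter k h y.
  by elim: k => //= k ->; rewrite linearD.
have hlow k : (k < m.+1)%N -> iter m.+1 h (comb e (r *m C ^+ k)) = 0.
  move=> km; rewrite -[X in iter X](subnK (ltnW km)) iterD hpow.
  by rewrite -(prednK (n := _ - _)) ?subn_gt0 // iterSr hr0 iter0.
have := Cayley_Hamilton C; set p := char_poly C => pC.
have sp : size p = m.+2 by rewrite size_char_poly.
have pE : horner_mx C p = \sum_(i < m.+2) p`_i *: C ^+ i.
  rewrite -[in LHS](coefK p) sp poly_def linear_sum /=.
  by apply: eq_bigr => i _; rewrite linearZ /= rmorphXn /= horner_mx_X.
have : iter m.+1 h (comb e (r *m horner_mx C p)) = 0.
  by rewrite pC mulmx0 comb0 iter0.
rewrite pE mulmx_sumr comb_sum (big_morph _ (itD m.+1) (iter0 m.+1)).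
rewrite big_ord_recr /= big1 ?add0r => [|i _].
  have -> : p`_m.+1 = 1.
    by have /monicP := char_poly_monic C; rewrite lead_coefE sp.
  by rewrite scale1r -/(iter m.+1 h _) hpow.
rewrite -scalemxAr combZ; have iterZ k a x : iter k h (a *: x) = a *: iter k h x.
  by elim: k => //= k ->; rewrite linearZ.
by rewrite -/(iter m.+1 h _) iterZ hlow ?scaler0.
Qed.


Lemma iter_linear (A : pzRingType) (U : lmodType A) (h : {linear U -> U}) k :
  linear (iter k h).
Proof. by elim: k => // k IH a x y /=; rewrite IH linearP. Qed.

Lemma iter_linear0 (A : pzRingType) (U : lmodType A) (h : {linear U -> U}) k :
  iter k h 0 = 0.
Proof. exact: (linear0 (lin (iter_linear h k))). Qed.

Section ArtinModules.
Variables (R : comNzRingType) (A : algType R) (hA : artin_algebra A).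
Implicit Types U M N X Y : fgmod A.

(** Products of generators of [A] over [R] and generators of [U] over [A] generate
[U] over [R]. *)
Lemma fg_base U : exists n (e : 'I_n -> U), forall v, exists r, v = comb e r.
Proof.
have [_ [n [a ha]]] := hA; have [m [u hu]] := fgmodP U.
pose I : finType := ('I_m * 'I_n)%type.
exists #|I|, (fun k => a (enum_val k).2 *: u (enum_val k).1) => v.
have [c ->] := hu v; pose d j := projT1 (cid (ha (c j))).
have dP j : c j = \sum_i d j i *: a i by rewrite /d; case: cid.
exists (\row_k d (enum_val k).1 (enum_val k).2).
under eq_bigr do rewrite dP scaler_suml.
rewrite pair_big /comb.
transitivity (\sum_(x in {: I}) (d x.1 x.2)%:A *: (a x.2 *: u x.1)).
  apply: eq_big => [x|[j i] _ /=]; first by rewrite inE.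
  by rewrite -[d j i *: _]mulr_algl -scalerA.
by rewrite big_enum_val; apply: eq_bigr => k _; rewrite mxE.
Qed.

(** A submodule is determined by its preimage under a surjection from [R ^ n]. *)
Lemma submodule_dcc U (S : nat -> set U) :
  (forall k, [/\ S k 0, forall x y, S k x -> S k y -> S k (x + y)
      & forall (a : A) x, S k x -> S k (a *: x)]) ->
  (forall k, S k.+1 `<=` S k)%classic -> stationary S.
Proof.
move=> Ssub Sdec; have [n [e he]] := fg_base U.
have [Rart _] := hA.
pose T k : set 'rV[R]_n := fun r => S k (comb e r).
have [k|k x Tx|k kP] := @row_dcc R n T Rart.
- have [S0 SD SZ] := Ssub k; split.
  + by rewrite /T comb0.
  + by move=> x y Tx Ty; rewrite /T combD; exact: SD.
  + by move=> a x Tx; rewrite /T combZ; exact: SZ.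
- exact: Sdec.
exists k => m km; apply/funext => v; have [r ->] := he v.
exact: (congr1 (fun Q : set 'rV[R]_n => Q r) (kP m km)).
Qed.

(** Fitting's lemma: [e] projects onto the stable image of [h] along the kernel
of a power of [h]. The images stabilise by the descending chain condition, and
then [h ^ n] maps its image onto itself; by [comb_injective] it is injective
there, so that image and kernel meet in zero. *)
Lemma fitting U (h : {linear U -> U}) : exists n (e : {linear U -> U}),
  [/\ forall u, e (e u) = e u, forall u, iter n.+1 h (e u) = iter n.+1 h u,
      forall u, exists w, e u = iter n.+1 h w
    & forall u, iter n.+1 h u = 0 -> e u = 0].
Proof.
pose S k : set U := fun u => exists w, iter k h w = u.
have [k|k x [w <-]|n nP] := @submodule_dcc U S.
- split; first by exists 0; exact: iter_linear0.
  + move=> x y [u <-] [v <-]; exists (u + v).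
    exact: (linearD (lin (iter_linear h k))).
  + move=> a x [u <-]; exists (a *: u).
    exact: (linearZ_LR (lin (iter_linear h k))).
- by exists (h w); rewrite -iterSr.
have [f fE] : exists f : {linear U -> U}, forall u, f u = iter n.+1 h u.
  by exists (lin (iter_linear h n.+1)).
exists n.
have ff v : exists w, f v = f (f w).
  have : S (n.+1 + n.+1)%N (f v); first rewrite fE.
    rewrite nP; last by rewrite addSn leqW // leq_addr.
    by rewrite -(nP n.+1) //; exists v.
  by move=> [w wE]; exists w; rewrite -[LHS]wE iterD !fE.
have f_inj w : f (f w) = 0 -> f w = 0.
  have [m [g hg]] := fg_base U.
  pose C := \matrix_i projT1 (cid (hg (projT1 (cid (ff (g i)))))).
  have CP i : f (f (comb g (row i C))) = f (g i).
    rewrite rowK; case: (cid (hg _)) => r /= <-.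
    by case: (cid (ff _)).
  have fcomb r : f (comb g r) = comb (f \o g) r.
    by rewrite linear_sum; apply: eq_bigr => i _; rewrite linearZ.
  have [r ->] := hg w; rewrite fcomb; apply: (@comb_injective _ _ _ _ _ C f) => i.
  by rewrite -fcomb CP.
pose s v := projT1 (cid (ff v)).
have sP v : f (f (s v)) = f v by rewrite /s; case: cid.
have s_uniq v w : f (f w) = f v -> f (s v) = f w.
  move=> fw; apply/subr0_eq; rewrite -linearB; apply: f_inj.
  by rewrite !linearB sP fw subrr.
have eL : linear (f \o s).
  by move=> a x y /=; rewrite -linearP; apply: s_uniq; rewrite !linearP !sP.
exists (lin eL); split=> [u|u|u|u]; rewrite -?fE.
- by rewrite /=; apply: s_uniq; rewrite sP.
- exact: sP.
- by exists (s u); rewrite -fE.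
- by move=> fu; rewrite /= (@s_uniq u 0) !linear0 ?fu.
Qed.

Lemma fitting_bij U (h : {linear U -> U}) n :
  (forall u, iter n.+1 h u = 0 -> u = 0) ->
  (forall u, exists w, u = iter n.+1 h w) -> bijective h.
Proof.
move=> hI hS; apply: inj_surj_bij.
  move=> x y hxy; apply/subr0_eq; apply: hI; rewrite iterSr linearB hxy subrr.
  exact: iter_linear0.
by move=> y; have [w ->] := hS y; exists (iter n h w).
Qed.

Lemma indecomposable_idempotent N (e : {linear N -> N}) :
  indecomposable N -> (forall u, e (e u) = e u) ->
  (forall u, e u = 0) \/ (forall u, e u = u).
Proof.
move=> [_ Ni] eK; have [X [i [p [pi ip]]]] := split_idempotent eK.
have [Y [j [q [qj sum1]]]] := split_mono pi.
case: (Ni X Y (pair_liso pi qj sum1)) => [X0|Y0]; [left|right] => u.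
  by rewrite -ip (X0 (p u)) linear0.
by rewrite -ip -[RHS]sum1 (Y0 (q u)) linear0 addr0.
Qed.

Lemma indecomposable_endo N (h : {linear N -> N}) : indecomposable N ->
  bijective h \/ exists n, forall u, iter n h u = 0.
Proof.
move=> Ni; have [n [e [eK fe eS fe0]]] := fitting h.
case: (indecomposable_idempotent Ni eK) => e01.
  right; exists n.+1 => u; rewrite -fe e01.
  exact: iter_linear0.
left; apply: (@fitting_bij _ _ n) => u; first by move/fe0; rewrite e01.
by rewrite -[u]e01; exact: eS.
Qed.

Lemma not_zero_inj_nilpotent N (h : {linear N -> N}) n : ~ is_zero N ->
  injective h -> ~ forall u, iter n h u = 0.
Proof.
move=> N0 hI h0; apply: N0 => v; elim: n h0 => [|n IH] h0; first exact: h0.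
apply: IH => u; apply: hI; rewrite linear0; exact: h0.
Qed.

(** The endomorphism ring of an indecomposable module is local: an endomorphism
that is not invertible is nilpotent. *)
Lemma indecomposable_local N (u v w : {linear N -> N}) : indecomposable N ->
  bijective w -> (forall x, w x = u x + v x) -> bijective u \/ bijective v.
Proof.
move=> Ni /inv_linear[w' [wK w'K]] wE.
case: (indecomposable_endo (u \o w') Ni) => [ub|[n un]].
  left; apply: (@eq_bij _ _ (u \o w' \o w)) => [|x /=]; last by rewrite wK.
  by apply: bij_comp ub _; exists w'.
right; case: (indecomposable_endo (v \o w') Ni) => [vb|[m vm]].
  apply: (@eq_bij _ _ (v \o w' \o w)) => [|x /=]; last by rewrite wK.
  by apply: bij_comp vb _; exists w'.
exfalso; apply: (@not_zero_inj_nilpotent N (v \o w') m Ni.1 _ vm).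
have fix0 x : v (w' x) = 0 -> x = 0.
  move=> vx; have ux : u (w' x) = x by rewrite -[RHS]w'K wE vx addr0.
  by rewrite -(un x); elim: n {un} => //= n <-; rewrite ux.
move=> x y /= vxy; apply/subr0_eq; apply: fix0; rewrite !linearB vxy.
by rewrite subrr.
Qed.

(** If a finite sum of maps [N -> M -> N] is invertible, one of them is, and the
module [M] that it passes through has [N] as a direct summand. *)
Lemma through_bij (C : fgmod A -> Prop) N (h : {linear N -> N}) :
  indecomposable N -> through C h -> bijective h ->
  exists2 M, C M & retract N M.
Proof.
move=> Ni; elim=> {h}[h h0 [g hK _]|h h' M s r CM _ IH hE hb].
  by case: Ni.1 => x; rewrite -[x]hK -[RHS]hK !h0.
case: (@indecomposable_local N (r \o s) h' h Ni hb hE) => [|/IH//].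
move=> /inv_linear[g [gK _]]; exists M => //.
by exists s, (g \o r).
Qed.

Lemma through_id_indecomposable (C : fgmod A -> Prop) N : indecomposable N ->
  through C (idfun : {linear N -> N}) -> exists2 M, C M & retract N M.
Proof. by move=> Ni tN; apply: (through_bij Ni tN); exists id. Qed.

(** * Krull-Schmidt theory *)

(** A sequence of proper direct summands would give a strictly descending chain
of submodules of the first module. *)
Lemma summand_ind (P : fgmod A -> Prop) :
  (forall M, (forall X Y, liso M (X * Y)%type -> ~ is_zero Y -> P X) -> P M) ->
  forall M, P M.
Proof.
move=> IH M; apply: contrapT => PM.
pose T := {N : fgmod A & {linear N -> M}}.
pose good (t : T) := injective (projT2 t) /\ ~ P (projT1 t).
pose im (t : T) : set M := fun v => exists u, projT2 t u = v.
have step (t : T) : {t' : T | good t -> good t' /\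
    (im t' `<=` im t)%classic /\ ~ (im t `<=` im t')%classic}.
  apply: cid; case: (pselect (good t)) => [[tI tP]|]; last by exists t.
  case: t tI tP => N j /= jI NP.
  have [X [Y [NXY [Y0 PX]]]] : exists X Y : fgmod A,
      liso N (X * Y)%type /\ ~ is_zero Y /\ ~ P X.
    apply: contrapT => none; apply: NP; apply: IH => X Y NXY Y0.
    by apply: contrapT => PX; apply: none; exists X, Y.
  have [f fB] := NXY; have [g [fK gK]] := inv_linear fB.
  pose k : {linear X -> M} := j \o g \o inL X Y.
  exists (existT (fun N : fgmod A => {linear N -> M}) X k) => _.
  split; first split=> //=.
    by move=> x y /= /jI /(can_inj gK)[].
  split=> [v [x <-]|sub]; first by exists (g (x, 0)).
  apply: Y0 => y; have [x /= /jI/(can_inj gK)] := sub _ (ex_intro _ (g (0, y)) erefl).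
  by case.
pose t0 : T := existT (fun N : fgmod A => {linear N -> M}) M idfun.
pose t n : T := iter n (fun t => sval (step t)) t0.
have tgood n : good (t n).
  elim: n => [|n IHn]; first by split.
  by rewrite /t /=; case: (step _) => t' /= /(_ IHn)[].
have tS n : (im (t n.+1) `<=` im (t n))%classic /\
    ~ (im (t n) `<=` im (t n.+1))%classic.
  rewrite {1 4}/t /= -/(t n); case: (step _) => t' /=.
  by move=> /(_ (tgood n))[].
have [k|k|n nP] := @submodule_dcc M (fun k => im (t k)).
- split; first by exists 0; rewrite linear0.
  + by move=> x y [u <-] [v <-]; exists (u + v); rewrite linearD.
  + by move=> a x [u <-]; exists (a *: u); rewrite linearZ.
- by have [] := tS k.
have [_] := tS n; rewrite (nP n.+1 (leqnSn n)) => strict.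
by exfalso; apply: strict.
Qed.

(** Existence of decompositions into indecomposables, as an induction
principle. *)
Lemma fgmod_ind (P : fgmod A -> Prop) :
  (forall M, is_zero M -> P M) -> (forall M, indecomposable M -> P M) ->
  (forall M X Y, liso M (X * Y)%type -> P X -> P Y -> P M) ->
  forall M, P M.
Proof.
move=> P0 Pi PD; apply: summand_ind => M IH.
have [M0|M0] := pselect (is_zero M); first exact: P0.
have [|nMi] := pselect (indecomposable M); first exact: Pi.
have [X [Y [MXY [X0 Y0]]]] : exists X Y : fgmod A,
    liso M (X * Y)%type /\ ~ is_zero X /\ ~ is_zero Y.
  apply: contrapT => none; apply: nMi; split=> // X Y MXY.
  have [|X0] := pselect (is_zero X); first by left.
  right; apply: contrapT => Y0; apply: none; by exists X, Y.
apply: (PD _ _ _ MXY); first exact: IH MXY Y0.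
exact: IH (liso_trans MXY (liso_prodC _ _)) X0.
Qed.

(** Since [End N] is local, an isomorphism can be composed with a shear so that
its entry [N -> N] becomes invertible, and that entry is then used as a pivot. *)
Lemma indecomposable_cancel N X Y : indecomposable N ->
  liso (N * X)%type (N * Y)%type -> liso X Y.
Proof.
move=> Ni [T /inv_linear[T' [TK T'K]]].
have pivot (S : {linear (N * X)%type -> (N * Y)%type}) : bijective S ->
    bijective (outL N Y \o S \o inL N X) -> liso X Y.
  move=> /inv_linear[S' [SK S'K]] /inv_linear[a [aK Ka]].
  pose b := outL N Y \o S \o inR N X : {linear X -> N}.
  (* [c x] is the vector over [x] whose image has first component zero, and
     [x |-> S (c x)] is the Schur complement of the pivot. *)
  pose c : {linear X -> (N * X)%type} := inR N X \- (inL N X \o (a \o b)).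
  have c1 x : (S (c x)).1 = 0.
    rewrite /c /= linearB /=; have /= -> := Ka (b x).
    exact: subrr.
  exists (outR N Y \o (S \o c)); apply: inj_surj_bij => [x y /= xy|y].
    have : S (c x) = S (c y).
      by rewrite (surjective_pairing (S (c x))) (surjective_pairing (S (c y)))
        !c1 xy.
    move/(can_inj SK)/(congr1 snd).
    by rewrite /c /= !subr0.
  exists (S' (0, y)).2; have := S'K (0, y); set z := S' _ => Sy.
  suff cz : c z.2 = z by rewrite -[y]/(0 : N, y).2 -Sy -[in RHS]cz.
  have : (S z).1 = 0 by rewrite Sy.
  rewrite {1}(prod_split z) linearD /= => /eqP; rewrite addrC addr_eq0 => /eqP bE.
  rewrite [RHS]prod_split [RHS]addrC.
  rewrite -[LHS]/(inR N X z.2 - inL N X ((a \o b) z.2)); congr (_ + _).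
  have -> : (a \o b) z.2 = - z.1.
    by rewrite /b /= bE linearN; congr (- _); exact: (aK z.1).
  by rewrite linearN opprK.
pose a := outL N Y \o T \o inL N X : {linear N -> N}.
pose b' := outL N X \o T' \o inR N Y : {linear Y -> N}.
pose c := outR N Y \o T \o inL N X : {linear N -> Y}.
pose a' := outL N X \o T' \o inL N Y : {linear N -> N}.
have sum1 x : x = a' (a x) + b' (c x).
  have := TK (x, 0); rewrite [T _]prod_split linearD => /(congr1 fst) /=.
  exact: esym.
have TB : bijective T by exists T'.
have [aB|aB] := pselect (bijective a); first exact: pivot TB aB.
have a'aB : ~ bijective (a' \o a).
  move=> [g gK _]; case: (indecomposable_endo a Ni) => // -[n an].
  apply: (@not_zero_inj_nilpotent N a n Ni.1 _ an) => x y axy.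
  by rewrite -[x]gK -[y]gK; congr (g (a' _)).
case: (@indecomposable_local N (a' \o a) (b' \o c) idfun Ni) => // [|b'cB].
  by exists id.
(* The shear replaces the entry [a] by [a + b' c], which is invertible because
   [b' c] is and [a] is not. *)
pose sh : {linear (N * Y)%type -> (N * Y)%type} :=
  idfun \+ (inL N Y \o (b' \o outR N Y)).
have shB : bijective sh.
  exists (fun p => p - inL N Y (b' p.2)) => p.
    by rewrite -[sh p]/(p + inL N Y (b' p.2)) /= addr0 addrK.
  by rewrite -[sh _]/(_ + inL N Y (b' (p.2 - 0))) subr0 subrK.
pose T2 : {linear (N * X)%type -> (N * Y)%type} := sh \o T.
pose a2 : {linear N -> N} := outL N Y \o T2 \o inL N X.
apply: (pivot T2); first exact: bij_comp shB TB.
have sum2 x : (b' \o c) x = a2 x + - a x.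
  by rewrite -[a2 x]/(a x + b' (c x)) addrC addKr.
case: (@indecomposable_local N a2 (\- a) (b' \o c) Ni b'cB sum2) => //.
move=> [g gK Kg]; case: aB; exists (fun x => g (- x)) => x.
  exact: (gK x).
by apply: oppr_inj; exact: (Kg (- x)).
Qed.

Lemma liso_cancel (W : fgmod A) X Y : liso (W * X)%type (W * Y)%type -> liso X Y.
Proof.
move: X Y; elim/fgmod_ind: W => W.
- move=> W0 X Y WXY; apply: liso_trans (liso_trans WXY _).
    by apply: liso_sym; apply: liso_trans (liso_prodC _ _) (liso_prod0 _ W0).
  exact: liso_trans (liso_prodC _ _) (liso_prod0 _ W0).
- by move=> Wi X Y; exact: indecomposable_cancel.
move=> V V' WV IH IH' X Y WXY; apply: IH'.
apply: (IH (prod_fgmod V' X) (prod_fgmod V' Y)).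
have split (Z : fgmod A) : liso (W * Z)%type (V * (V' * Z))%type.
  apply: liso_trans (liso_prod WV (liso_refl Z)) _.
  by apply: liso_sym; exact: liso_prodA.
exact: liso_trans (liso_sym (split X)) (liso_trans WXY (split Y)).
Qed.

(** A decomposition of [M] into indecomposables, remembered only through its
effect on the identity of [M]. *)
Lemma through_indecomposables M : exists n (N : nat -> fgmod A),
  (forall i, (i < n)%N -> indecomposable (N i)) /\
  through (fun X => exists2 i, (i < n)%N & X = N i) (idfun : {linear M -> M}).
Proof.
elim/fgmod_ind: M => M.
- move=> M0; exists 0%N, (fun=> M); split=> //.
  by apply: through0 => x; exact: M0.
- move=> Mi; exists 1%N, (fun=> M); split=> //.
  by apply: (through1 (N := M) (s := idfun) (r := idfun)); first by exists 0%N.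
move=> X Y MXY [n [N [Ni tX]]] [m [L [Li tY]]].
pose K i := if (i < n)%N then N i else L (i - n)%N.
exists (n + m)%N, K; split.
  rewrite /K => i inm; case: ltnP => ni; first exact: Ni.
  by apply: Li; rewrite ltn_subLR.
apply: through_id_retract (liso_retract (Y := prod_fgmod X Y) MXY) _.
apply: through_id_prod.
  apply: through_sub tX => _ [i ni ->].
  apply: (through1 (N := N i) (s := idfun) (r := idfun)) => //.
  by exists i; rewrite /K ?ni // ltn_addr.
apply: through_sub tY => _ [i ni ->].
apply: (through1 (N := L i) (s := idfun) (r := idfun)) => //.
by exists (n + i)%N; rewrite /K ?ltn_add2l // ltnNge leq_addr addKn.
Qed.

Lemma liso_representatives (Q : fgmod A -> Prop) n (N : nat -> fgmod A) :
  exists m (L : nat -> fgmod A),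
  [/\ forall i, (i < m)%N -> Q (L i),
      forall i j, (i < j < m)%N -> ~ liso (L i) (L j)
    & forall i, (i < n)%N -> Q (N i) ->
        exists2 j, (j < m)%N & liso (N i) (L j)].
Proof.
elim: n => [|n [m [L [QL Lneq LN]]]].
  by exists 0%N, N; split=> // i j; rewrite ltn0 andbF.
have [[QN new]|old] := pselect (Q (N n) /\
    forall j, (j < m)%N -> ~ liso (N n) (L j)); last first.
  exists m, L; split=> // i; rewrite ltnS leq_eqVlt => /orP[/eqP->|]; last exact: LN.
  move=> QN; apply: contrapT => none; apply: old; split=> // j jm NL.
  by apply: none; exists j.
pose L' i := if (i < m)%N then L i else N n.
have L'm : L' m = N n by rewrite /L' ltnn.
have L'E i : (i < m)%N -> L' i = L i by rewrite /L' => ->.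
exists m.+1, L'; split.
- move=> i; rewrite ltnS leq_eqVlt => /orP[/eqP->|im]; first by rewrite L'm.
  by rewrite L'E //; exact: QL.
- move=> i j; rewrite ltnS [(j <= m)%N]leq_eqVlt => /andP[ij /orP[/eqP jm|jm]].
    rewrite jm in ij *; rewrite L'm L'E // => /liso_sym; exact: new ij.
  rewrite !L'E ?(ltn_trans ij) //; exact/Lneq/andP.
move=> i; rewrite ltnS leq_eqVlt => /orP[/eqP->|im] Qi.
  by exists m => //; rewrite L'm; exact: liso_refl.
by have [j jm NL] := LN i im Qi; exists j; rewrite ?L'E // ltnW.
Qed.

End ArtinModules.

(** * Relative projectives and the stable category *)

Section Stable.
Variables (A : pzRingType) (F : ext_class A).
Implicit Types K M N P Q X Y Z : fgmod A.

Local Notation Fproj := (F_projective F).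

Definition lifts_projectives Y Z (g : {linear Y -> Z}) :=
  forall Q (h : {linear Q -> Z}), Fproj Q ->
    exists h' : {linear Q -> Y}, forall x, g (h' x) = h x.

Lemma F_epi_lifts Y Z (g : {linear Y -> Z}) : F_epi F g -> lifts_projectives g.
Proof.
move=> [X [f fg]] Q h Qp; have [_ _ lift] := Qp _ _ _ _ _ fg.
have [h' h'E] := lift (h : Defs.hom Q Z); exists (h' : {linear Q -> Y}) => x.
exact: (congr1 (fun k : Defs.hom Q Z => (k : {linear Q -> Z}) x) h'E).
Qed.

Lemma through_lift X Y Z (g : {linear Y -> Z}) (h : {linear X -> Z}) :
  lifts_projectives g -> through Fproj h ->
  exists h' : {linear X -> Y}, forall x, g (h' x) = h x.
Proof.
move=> gl; elim=> {}h.
  by move=> h0; exists \0 => x; rewrite h0 linear0.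
move=> h1 N s r Np _ [k kE] hE; have [l lE] := gl _ r Np.
by exists ((l \o s) \+ k) => x; rewrite linearD kE hE /= lE.
Qed.

(** Only surjectivity of [Hom(Q, Y) -> Hom(Q, Z)] matters, and maps that lift
form an ideal; so the projectives are detected by their identity. *)
Lemma F_projective_through Q :
  through Fproj (idfun : {linear Q -> Q}) -> Fproj Q.
Proof.
move=> tQ X Y Z f g fg.
have gl : lifts_projectives g by apply: F_epi_lifts; exists X, f.
have [[f_inj f_ker _] _] := fg.
split.
- move=> u v uv; apply: hom_ext => x; apply: f_inj.
  exact: (congr1 (fun k : Defs.hom Q Y => (k : {linear Q -> Y}) x) uv).
- move=> v; split=> [gv|[u <-]].
    have [x|a aE] := @lift_mono _ _ _ _ f (v : {linear Q -> Y}) f_inj.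
      apply/f_ker.
      exact: (congr1 (fun k : Defs.hom Q Z => (k : {linear Q -> Z}) x) gv).
    by exists (a : Defs.hom Q X); apply: hom_ext.
  by apply: hom_ext => x /=; apply/f_ker; exists ((u : {linear Q -> X}) x).
move=> w; have tw : through Fproj (w : {linear Q -> Z}).
  exact: (through_id_comp (g := idfun) (f := w) tQ).
have [h' h'E] := through_lift gl tw.
by exists (h' : Defs.hom Q Y); apply: hom_ext.
Qed.

Lemma F_projective_id Q : Fproj Q -> through Fproj (idfun : {linear Q -> Q}).
Proof. by move=> Qp; exact: (through1 (s := idfun) (r := idfun) Qp). Qed.

Lemma F_projective_retract P Q : retract P Q -> Fproj Q -> Fproj P.
Proof.
move=> PQ /F_projective_id tQ; apply: F_projective_through.
exact: through_id_retract PQ tQ.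
Qed.

Lemma F_projective_prod P Q : Fproj P -> Fproj Q -> Fproj (prod_fgmod P Q).
Proof.
move=> /F_projective_id tP /F_projective_id tQ; apply: F_projective_through.
exact: through_id_prod.
Qed.

Lemma F_projective_zero Z : is_zero Z -> Fproj Z.
Proof. by move=> Z0; apply: F_projective_through; exact: through0. Qed.

Lemma through_projective X Y (h : {linear X -> Y}) : through Fproj h ->
  exists P (a : {linear X -> P}) (b : {linear P -> Y}),
    Fproj P /\ forall x, h x = b (a x).
Proof.
elim=> {}h.
  move=> h0; exists (fgmod0 A), \0, \0; split=> [|x]; last by rewrite h0.
  exact: F_projective_zero (@fgmod0P A).
move=> h1 N s r Np _ [P [a [b [Pp hE1]]]] hE.
pose a' : {linear X -> prod_fgmod N P} := (inL N P \o s) \+ (inR N P \o a).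
pose b' : {linear prod_fgmod N P -> Y} := (r \o outL N P) \+ (b \o outR N P).
exists (prod_fgmod N P), a', b'; split; first exact: F_projective_prod.
by move=> x; rewrite hE hE1 /= addr0 add0r.
Qed.

(** [X] and [Y] are isomorphic in the quotient of the module category by the
maps that factor through an [F]-projective module. *)
Definition stable_iso X Y :=
  exists (f : {linear X -> Y}) (g : {linear Y -> X}),
    through Fproj (idfun \- (g \o f) : {linear X -> X}) /\
    through Fproj (idfun \- (f \o g) : {linear Y -> Y}).

Lemma stable_iso_sym X Y : stable_iso X Y -> stable_iso Y X.
Proof. by move=> [f [g [gf fg]]]; exists g, f. Qed.

Lemma liso_stable_iso X Y : liso X Y -> stable_iso X Y.
Proof.
move=> [f /inv_linear[g [fK gK]]]; exists f, g.
by split; apply: through0 => x /=; rewrite ?fK ?gK subrr.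
Qed.

Lemma stable_iso_trans Y X Z : stable_iso X Y -> stable_iso Y Z ->
  stable_iso X Z.
Proof.
have half (U V W : fgmod A) (f : {linear U -> V}) (g : {linear V -> U})
    (f' : {linear V -> W}) (g' : {linear W -> V}) :
    through Fproj (idfun \- (g \o f) : {linear U -> U}) ->
    through Fproj (idfun \- (g' \o f') : {linear V -> V}) ->
    through Fproj (idfun \- ((g \o g') \o (f' \o f)) : {linear U -> U}).
  move=> gf gf'; pose k : {linear U -> U} := g \o (idfun \- (g' \o f')) \o f.
  have tk : through Fproj k by exact: (through_comp gf').
  by apply: (through_add gf tk) => x /=; rewrite linearB /= addrA subrK.
move=> [f [g [gf fg]]] [f' [g' [gf' fg']]].
exists (f' \o f), (g \o g'); split; exact: half.
Qed.

Lemma stable_iso_prod X X' Y Y' : stable_iso X X' -> stable_iso Y Y' ->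
  stable_iso (prod_fgmod X Y) (prod_fgmod X' Y').
Proof.
have half (U U' V V' : fgmod A) (f : {linear U -> U'}) (g : {linear U' -> U})
    (f' : {linear V -> V'}) (g' : {linear V' -> V}) :
    through Fproj (idfun \- (g \o f) : {linear U -> U}) ->
    through Fproj (idfun \- (g' \o f') : {linear V -> V}) ->
    through Fproj (idfun \- (prod_map g g' \o prod_map f f') :
      {linear prod_fgmod U V -> prod_fgmod U V}).
  move=> gf gf'; pose P := prod_fgmod U V.
  pose k : {linear P -> P} := inL U V \o (idfun \- (g \o f)) \o outL U V.
  pose l : {linear P -> P} := inR U V \o (idfun \- (g' \o f')) \o outR U V.
  have tk : through Fproj k by exact: (through_comp gf).
  have tl : through Fproj l by exact: (through_comp gf').
  by apply: (through_add tk tl) => -[x y]; congr pair; rewrite /= ?addr0 ?add0r.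
move=> [f [g [gf fg]]] [f' [g' [gf' fg']]].
exists (prod_map f f' : {linear prod_fgmod X Y -> prod_fgmod X' Y'}).
exists (prod_map g g' : {linear prod_fgmod X' Y' -> prod_fgmod X Y}).
by split; exact: half.
Qed.

Lemma stable_iso_projective P Q : Fproj P -> Fproj Q -> stable_iso P Q.
Proof.
move=> /F_projective_id tP /F_projective_id tQ; exists \0, \0.
by split; [apply: (through_comp (g := idfun) (f := idfun) tP)
         |apply: (through_comp (g := idfun) (f := idfun) tQ)] => x /=;
  rewrite subr0.
Qed.

Lemma stable_iso_addl P X : Fproj P -> stable_iso X (prod_fgmod X P).
Proof.
move=> Pp; have Z0 := @fgmod0P A.
apply: (stable_iso_trans (Y := prod_fgmod X (fgmod0 A))).
  by apply: liso_stable_iso; apply: liso_sym; exact: liso_prod0.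
apply: stable_iso_prod; first exact/liso_stable_iso/liso_refl.
exact: stable_iso_projective (F_projective_zero Z0) Pp.
Qed.

(** If [1 - g f] factors as [X -> P -> X], then [(f, a)] splits [X] off [Y + P];
the complement is zero in the stable category, hence projective. *)
Lemma stable_isoP X Y : stable_iso X Y <->
  exists P Q, [/\ Fproj P, Fproj Q & liso (X * Q)%type (Y * P)%type].
Proof.
split=> [|[P [Q [Pp Qp XY]]]]; last first.
  apply: stable_iso_trans (stable_iso_addl X Qp) _.
  apply: stable_iso_trans (stable_iso_sym (stable_iso_addl Y Pp)).
  exact: (@liso_stable_iso (prod_fgmod X Q) (prod_fgmod Y P)).
move=> [f [g [/through_projective[P [a [b [Pp gfE]]]] fg]]].
pose i : {linear X -> prod_fgmod Y P} := (inL Y P \o f) \+ (inR Y P \o a).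
pose p : {linear prod_fgmod Y P -> X} := (g \o outL Y P) \+ (b \o outR Y P).
have pi : cancel i p.
  by move=> x; rewrite /= addr0 add0r -gfE /= addrC subrK.
have [Q [j [q [qj sum1]]]] := split_mono pi.
exists P, Q; split=> //; last exact: liso_sym (pair_liso pi qj sum1).
have pj x : p (j x) = 0.
  have := sum1 (j x); rewrite qj -[RHS]add0r => /addIr ipj.
  by rewrite -[LHS]pi ipj !linear0.
pose y : {linear Q -> Y} := outL Y P \o j.
pose z : {linear Q -> P} := outR Y P \o j.
pose ql : {linear Y -> Q} := q \o inL Y P.
pose qr : {linear P -> Q} := q \o inR Y P.
(* On [Q] the relation [g y = - b z] holds, so the identity
   [q (inL y) + q (inR z)] is [h2], where [1 - f g] occurs, plus [h1], which
   passes through [P]. *)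
pose h1 : {linear Q -> Q} := (qr \- (ql \o (f \o b))) \o z.
pose h2 : {linear Q -> Q} := ql \o (idfun \- (f \o g)) \o y.
apply: F_projective_through.
have t1 : through Fproj h1.
  exact: (through1 (s := z) (r := qr \- (ql \o (f \o b))) Pp).
have t2 : through Fproj h2 by exact: (through_comp fg).
apply: (through_add t1 t2) => x.
have gy : g (y x) = - b (z x) by apply/eqP; rewrite -addr_eq0; apply/eqP/pj.
rewrite -[LHS]/x -[LHS]qj [j x]prod_split linearD.
rewrite -[RHS]/(qr (z x) - ql (f (b (z x))) + ql (y x - f (g (y x)))).
rewrite gy !linearN opprK [ql (_ + _)]linearD [RHS]addrACA addNr addr0.
exact: addrC.
Qed.

(** * Syzygies *)

(** An exact sequence [0 -> K -> P -> Z -> 0] with which syzygies can be computed.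
Only the lifting property of the [F]-epimorphism is recorded, so that direct
sums of presentations are presentations at once. *)
Definition presentation K P Z (i : {linear K -> P}) (g : {linear P -> Z}) :=
  [/\ short_exact i g, Fproj P & lifts_projectives g].

(** Half of a homotopy equivalence between two presentations, read off on the
kernels: [al] extends to the projectives, and [al be] is the identity up to a
map that extends to [P]. *)
Definition half_homotopy K P K' P' (i : {linear K -> P}) (i' : {linear K' -> P'})
    (al : {linear K' -> K}) (be : {linear K -> K'}) :=
  (exists t : {linear P' -> P}, forall x, i (al x) = t (i' x)) /\
  (exists s : {linear P -> K}, forall x, x = al (be x) + s (i x)).

Definition homotopic K P K' P' (i : {linear K -> P}) (i' : {linear K' -> P'}) :=
  exists al be, half_homotopy i i' al be /\ half_homotopy i' i be al.

Section Compare.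
Variables K P Z K' P' Z' : fgmod A.
Variables (i : {linear K -> P}) (g : {linear P -> Z}).
Variables (i' : {linear K' -> P'}) (g' : {linear P' -> Z'}).
Hypotheses (pg : presentation i g) (pg' : presentation i' g').

Lemma presentation_map (c : {linear Z -> Z'}) :
  exists (t : {linear P -> P'}) (be : {linear K -> K'}),
    (forall x, g' (t x) = c (g x)) /\ (forall x, i' (be x) = t (i x)).
Proof.
have [[i_inj kg _] Pp _] := pg; have [[i'_inj kg' _] _ gl'] := pg'.
have [t tE] := gl' P (c \o g) Pp; exists t.
have [x|be beE] := @lift_mono _ _ _ _ i' (t \o i) i'_inj.
  by apply/kg'; rewrite tE /= (_ : g (i x) = 0) ?linear0 //; apply/kg; exists x.
by exists be.
Qed.

Lemma presentation_homotopy (c : {linear Z -> Z'}) (c' : {linear Z' -> Z})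
    (t' : {linear P -> P'}) (t : {linear P' -> P})
    (be : {linear K -> K'}) (al : {linear K' -> K}) :
  through Fproj (idfun \- (c' \o c) : {linear Z -> Z}) ->
  (forall x, g' (t' x) = c (g x)) -> (forall x, i' (be x) = t' (i x)) ->
  (forall x, g (t x) = c' (g' x)) -> (forall x, i (al x) = t (i' x)) ->
  half_homotopy i i' al be.
Proof.
have [[i_inj kg _] Pp gl] := pg => cc' gt' it' gt it.
have [w wE] := through_lift gl cc'; split; first by exists t.
pose d : {linear P -> P} := idfun \- ((t \o t') \+ (w \o g)).
have [x|s sE] := @lift_mono _ _ _ _ i d i_inj.
  apply/kg; rewrite -[d x]/(x - (t (t' x) + w (g x))) linearB linearD wE gt gt'.
  by rewrite /= [c' _ + _]addrC subrK subrr.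
exists s => x; apply: i_inj; rewrite linearD sE it it' /=.
have -> : g (i x) = 0 by apply/kg; exists x.
by rewrite linear0 addr0 [t _ + _]addrC subrK.
Qed.

Lemma half_homotopy_descends (t : {linear P' -> P})
    (al : {linear K' -> K}) : (forall x, i (al x) = t (i' x)) ->
  exists c : {linear Z' -> Z}, forall x, c (g' x) = g (t x).
Proof.
have [[_ kg _] _ _] := pg; have [[_ kg' gS'] _ _] := pg' => it.
apply: (@factor_epi _ _ _ _ g' (g \o t)) => // p /kg'[x <-] /=.
by rewrite -it; apply/kg; exists (al x).
Qed.

Lemma half_homotopy_through (c : {linear Z -> Z'}) (c' : {linear Z' -> Z})
    (t' : {linear P -> P'}) (t : {linear P' -> P})
    (be : {linear K -> K'}) (al : {linear K' -> K}) (s : {linear P -> K}) :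
  (forall x, c (g x) = g' (t' x)) -> (forall x, i' (be x) = t' (i x)) ->
  (forall x, c' (g' x) = g (t x)) -> (forall x, i (al x) = t (i' x)) ->
  (forall x, x = al (be x) + s (i x)) ->
  through Fproj (idfun \- (c' \o c) : {linear Z -> Z}).
Proof.
have [[i_inj kg gS] Pp gl] := pg => gt' it' gt it sE.
pose d : {linear P -> P} := idfun \- ((t \o t') \+ (i \o s)).
have [_ /kg[x <-]|w wE] := @factor_epi _ _ _ _ g d gS.
  rewrite -[d _]/(i x - (t (t' (i x)) + i (s (i x)))) -it' -it -linearD -sE.
  exact: subrr.
apply: (through1 (s := w) (r := g) Pp) => z; have [p <-] := gS z.
rewrite wE -[d p]/(p - (t (t' p) + i (s p))) linearB linearD.
have -> : g (i (s p)) = 0 by apply/kg; exists (s p).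
by rewrite addr0 -gt -gt'.
Qed.

End Compare.

(** The syzygy is a functor on the stable category. *)
Lemma stable_homotopic K P Z K' P' Z' (i : {linear K -> P})
    (g : {linear P -> Z}) (i' : {linear K' -> P'}) (g' : {linear P' -> Z'}) :
  presentation i g -> presentation i' g' -> stable_iso Z Z' -> homotopic i i'.
Proof.
move=> pg pg' [c [c' [cc' c'c]]].
have [t' [be [gt' it']]] := presentation_map pg pg' c.
have [t [al [gt it]]] := presentation_map pg' pg c'.
exists al, be; split.
  exact: (presentation_homotopy pg cc' gt' it' gt it).
exact: (presentation_homotopy pg' c'c gt it gt' it').
Qed.

(** Conversely [Z] is the cokernel of [i], and a homotopy on the kernels induces
one on the cokernels. *)
Lemma homotopic_stable K P Z K' P' Z' (i : {linear K -> P})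
    (g : {linear P -> Z}) (i' : {linear K' -> P'}) (g' : {linear P' -> Z'}) :
  presentation i g -> presentation i' g' -> homotopic i i' -> stable_iso Z Z'.
Proof.
move=> pg pg' [al [be [[[t it] [s sE]] [[t' it'] [s' sE']]]]].
have [c' gt] := half_homotopy_descends pg pg' it.
have [c gt'] := half_homotopy_descends pg' pg it'.
exists c, c'; split.
  exact: (half_homotopy_through pg gt' it' gt it sE).
exact: (half_homotopy_through pg' gt it gt' it' sE').
Qed.

Lemma stable_syzygy K P Z K' P' Z' (i : {linear K -> P})
    (g : {linear P -> Z}) (i' : {linear K' -> P'}) (g' : {linear P' -> Z'}) :
  presentation i g -> presentation i' g' -> stable_iso Z Z' -> stable_iso K K'.
Proof.
move=> pg pg' /(stable_homotopic pg pg').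
move=> [al [be [[_ [s sE]] [_ [s' sE']]]]]; exists be, al.
have [_ Pp _] := pg; have [_ Pp' _] := pg'.
split; [apply: (through1 (s := i) (r := s) Pp)
       |apply: (through1 (s := i') (r := s') Pp')] => x /=.
  by rewrite {1}(sE x) addrC addKr.
by rewrite {1}(sE' x) addrC addKr.
Qed.

Lemma presentation_prod K P Z K' P' Z' (i : {linear K -> P})
    (g : {linear P -> Z}) (i' : {linear K' -> P'}) (g' : {linear P' -> Z'}) :
  presentation i g -> presentation i' g' ->
  @presentation (prod_fgmod K K') (prod_fgmod P P') (prod_fgmod Z Z')
    (prod_map i i') (prod_map g g').
Proof.
move=> [e Pp gl] [e' Pp' gl']; split.
- exact: (dsum_exact (Extension e) (Extension e')).
- exact: F_projective_prod.
move=> Q h Qp; have [k kE] := gl Q (outL Z Z' \o h) Qp.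
have [k' kE'] := gl' Q (outR Z Z' \o h) Qp.
exists ((inL P P' \o k) \+ (inR P P' \o k')) => x.
rewrite [RHS]prod_split; congr pair; rewrite /=.
  by rewrite !addr0 kE.
by rewrite !add0r kE'.
Qed.

Lemma presentation_id P : Fproj P ->
  @presentation (fgmod0 A) P P \0 idfun.
Proof.
move=> Pp; split=> // [|Q h _]; last by exists h.
split=> [x y _|v|w]; last by exists w.
  by rewrite (fgmod0P x) (fgmod0P y).
by split=> [/= ->|[u <-]]; first exists 0.
Qed.

End Stable.

(** * Computing in the Grothendieck group *)

Section KGroup.
Variables (A : pzRingType) (F : ext_class A).
Implicit Types (x y z : K_expr A) (X Y Z : fgmod A).

Lemma K_eq_zero_module Z : is_zero Z -> K_eq F (K_gen Z) (K_zero A).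
Proof. by move=> Z0; apply: K_proj; exact: F_projective_zero. Qed.

Lemma K_addr0 (x : K_expr A) : K_eq F (K_add x (K_zero A)) x.
Proof. exact: K_trans (K_addC _ _ _) (K_add0 _ _). Qed.

Lemma K_gen_prod X Y :
  K_eq F (K_gen (prod_fgmod X Y)) (K_add (K_gen X) (K_gen Y)).
Proof. exact: (@K_sum _ F (prod_fgmod X Y) X Y (liso_refl _)). Qed.


Lemma K_addACA x y z w : K_eq F (K_add (K_add x y) (K_add z w))
  (K_add (K_add x z) (K_add y w)).
Proof.
apply: K_trans (K_sym (K_addA _ _ _ _)) _.
apply: K_trans (K_addA _ _ _ _).
apply: K_addE; first exact: K_refl.
apply: K_trans (K_addA _ _ _ _) _; apply: K_trans (K_sym (K_addA _ _ _ _)).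
exact: K_addE (K_addC _ _ _) (K_refl _ _).
Qed.

Lemma K_addNr x : K_eq F (K_add x (K_opp x)) (K_zero A).
Proof. exact: K_trans (K_addC _ _ _) (K_addN _ _). Qed.

Lemma K_addI x y z : K_eq F (K_add x z) (K_add y z) -> K_eq F x y.
Proof.
have addK w : K_eq F (K_add (K_add w z) (K_opp z)) w.
  apply: K_trans (K_sym (K_addA _ _ _ _)) _.
  exact: K_trans (K_addE (K_refl _ _) (K_addNr _)) (K_addr0 _).
move=> xyz; apply: K_trans (K_sym (addK x)) _; apply: K_trans (addK y).
exact: K_addE xyz (K_refl _ _).
Qed.

Lemma K_sub_eq0 x y : K_eq F (K_add x (K_opp y)) (K_zero A) <-> K_eq F x y.
Proof.
split=> [xy0|xy].
  apply: (@K_addI _ _ (K_opp y)); apply: K_trans xy0 _.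
  exact: K_sym (K_addNr y).
exact: K_trans (K_addE xy (K_refl _ _)) (K_addNr y).
Qed.

Lemma iter_K_Omega_add m x y : iter m (K_Omega F) (K_add x y) =
  K_add (iter m (K_Omega F) x) (iter m (K_Omega F) y).
Proof. by elim: m => //= m ->. Qed.

Lemma iter_K_Omega_opp m x :
  iter m (K_Omega F) (K_opp x) = K_opp (iter m (K_Omega F) x).
Proof. by elim: m => //= m ->. Qed.

Lemma iter_K_Omega_zero m : iter m (K_Omega F) (K_zero A) = K_zero A.
Proof. by elim: m => //= m ->. Qed.

End KGroup.

(** * Relative projective covers and syzygy modules *)

Section Covers.
Variables (R : comNzRingType) (A : algType R) (F : ext_class A).
Hypotheses (hA : artin_algebra A) (hF : additive_subfunctor F).
Hypothesis hproj : enough_projectives F.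
Implicit Types K M N P Q X Y Z : fgmod A.

Local Notation Fproj := (F_projective F).

(** The kernel of [g i] is the image of the kernel of [g] under the retraction,
and the sequence of [g i] is the pushout of that of [g]. *)
Lemma F_epi_retract P X M (g : {linear P -> M}) (i : {linear X -> P})
    (p : {linear P -> X}) :
  F_epi F g -> cancel i p -> (forall x, g (i (p x)) = g x) -> F_epi F (g \o i).
Proof.
move=> [K [f [e Fe]]] pi gip; have [f_inj kg gS] := e.
pose gi : {linear X -> M} := g \o i.
have [x|a aE] := @lift_mono _ _ _ _ (ker_incl gi) (p \o f) (@ker_incl_inj _ _ _ gi).
  by apply: ker_incl_ex; rewrite /= gip; apply/kg; exists x.
have aS y : exists x, a x = y.
  have /kg[x xE] : g (i (ker_incl gi y)) = 0 by exact: (@ker_inclP _ _ _ gi y).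
  by exists x; apply: (@ker_incl_inj _ _ _ gi); rewrite aE /= xE pi.
pose K1 := FGMod (finitely_generated_surj aS (fgmodP K)).
have e1 : @short_exact K1 X M (ker_incl gi) gi.
  split; first exact: ker_incl_inj.
  - move=> v; split; first exact: ker_incl_ex.
    by move=> [u <-]; exact: ker_inclP.
  - by move=> w; have [v <-] := gS w; exists (p v); rewrite /= gip.
exists K1, (ker_incl gi), e1.
apply: (@asf_pushout A F hF M K K1 a (Extension e) (Extension e1) _ Fe).
exists p; split=> [x|y]; first exact: esym (aE x).
exact: gip.
Qed.

(** If [g h = g] with [h] not bijective, then the stable image of [h] is a proper
summand of [P] by Fitting's lemma, and [g] restricts to an [F]-epimorphism on
it. Passing to summands, this ends in a right minimal [g]. *)
Lemma projective_cover_ex M :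
  exists P (g : {linear P -> M}), F_projective_cover F g.
Proof.
have [P [g [Pp ge]]] := hproj M.
elim/(summand_ind hA): P g Pp ge => P IH g Pp ge.
have [gmin|] := pselect (forall h : {linear P -> P},
    (forall x, g (h x) = g x) -> bijective h); first by exists P, g.
move/existsNP => [h] /not_implyP[gh hb].
have [n [e [eK he eS he0]]] := fitting hA h.
have [X [i [p [pi ip]]]] := split_idempotent eK.
have [Y [j [q [qj sum1]]]] := split_mono pi.
have giter k x : g (iter k h x) = g x by elim: k => //= k IHk; rewrite gh.
have gip x : g (i (p x)) = g x.
  by rewrite ip -[LHS](giter n.+1) he giter.
apply: (IH X Y (pair_liso pi qj sum1) _ (g \o i)).
- move=> Y0; have eE u : e u = u.
    by rewrite -[RHS]sum1 (Y0 (q u)) linear0 addr0 ip.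
  apply: hb; apply: (@fitting_bij _ _ P h n) => u; first by move/he0; rewrite eE.
  by have [w wE] := eS u; exists w; rewrite -wE eE.
- by apply: F_projective_retract Pp; exists i, p.
- exact: F_epi_retract ge pi gip.
Qed.

Lemma choose_spec (T : Type) (t0 : T) (P : T -> Prop) :
  (exists x, P x) -> P (Defs.choose t0 P).
Proof. by rewrite /Defs.choose; case: pselect => // ex _; case: cid. Qed.

Lemma Omega_presentation M :
  exists P (i : {linear Omega F M -> P}) (g : {linear P -> M}),
    presentation F i g.
Proof.
have [|P [i [g [[Pp ge _] e]]]] := @choose_spec _ M (is_syzygy F M).
  have [P [g gc]] := projective_cover_ex M; have [_ [K [f [e _]]] _] := gc.
  by exists K, P, f, g.
by exists P, i, g; split=> //; exact: F_epi_lifts.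
Qed.

Lemma Omega_stable X Y : stable_iso F X Y -> stable_iso F (Omega F X) (Omega F Y).
Proof.
have [P [i [g pg]]] := Omega_presentation X.
have [P' [i' [g' pg']]] := Omega_presentation Y.
exact: stable_syzygy pg pg'.
Qed.

Lemma Omega_prod X Y :
  stable_iso F (Omega F (prod_fgmod X Y)) (prod_fgmod (Omega F X) (Omega F Y)).
Proof.
have [P [i [g pg]]] := Omega_presentation X.
have [P' [i' [g' pg']]] := Omega_presentation Y.
have [P2 [i2 [g2 pg2]]] := Omega_presentation (prod_fgmod X Y).
apply: (stable_syzygy pg2 (presentation_prod pg pg')).
exact/liso_stable_iso/liso_refl.
Qed.

Lemma Omega_projective P : Fproj P -> stable_iso F (Omega F P) (fgmod0 A).
Proof.
move=> Pp; have [P' [i [g pg]]] := Omega_presentation P.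
apply: (stable_syzygy pg (presentation_id Pp)).
exact/liso_stable_iso/liso_refl.
Qed.

(** * The Grothendieck group as a group of differences *)

Lemma stable_cancel W X Y :
  stable_iso F (prod_fgmod W X) (prod_fgmod W Y) -> stable_iso F X Y.
Proof.
move=> /stable_isoP[P [Q [Pp Qp WXY]]]; apply/stable_isoP; exists P, Q.
split=> //; apply: (@liso_cancel _ _ hA W (prod_fgmod X Q) (prod_fgmod Y P)).
apply: liso_trans (liso_prodA _ _ _) _; apply: liso_trans WXY _.
by apply: liso_sym; exact: liso_prodA.
Qed.

(** An expression stands for the difference of its two parts. *)
Fixpoint K_parts (x : K_expr A) : fgmod A * fgmod A :=
  match x with
  | K_zero => (fgmod0 A, fgmod0 A)
  | K_gen M => (M, fgmod0 A)
  | K_add x y => (prod_fgmod (K_parts x).1 (K_parts y).1,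
                  prod_fgmod (K_parts x).2 (K_parts y).2)
  | K_opp x => ((K_parts x).2, (K_parts x).1)
  end.

Local Notation "X =~ Y" := (stable_iso F X Y) (at level 70).
Local Notation "X |*| Y" := (prod_fgmod X Y) (at level 40, left associativity).

Let sC X Y : X |*| Y =~ Y |*| X.
Proof. by apply: liso_stable_iso; exact: liso_prodC. Qed.

Let sA X Y Z : X |*| (Y |*| Z) =~ X |*| Y |*| Z.
Proof. by apply: liso_stable_iso; exact: liso_prodA. Qed.

Let sACA X Y Z W : (X |*| Y) |*| (Z |*| W) =~ (X |*| Z) |*| (Y |*| W).
Proof. by apply: liso_stable_iso; exact: liso_prodACA. Qed.

Let s0 X : X |*| fgmod0 A =~ X.
Proof. by apply: liso_stable_iso; exact: liso_prod0 (@fgmod0P A). Qed.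

Let sR X : X =~ X.
Proof. by apply: liso_stable_iso; exact: liso_refl. Qed.

Let sAC X Y Z W : (X |*| Y) |*| (Z |*| W) =~ (X |*| W) |*| (Z |*| Y).
Proof.
apply: stable_iso_trans (stable_iso_prod (sR _) (sC _ _)) _.
apply: stable_iso_trans (sACA _ _ _ _) _.
exact: stable_iso_prod (sR _) (sC _ _).
Qed.

(** Each rule of [K_eq] becomes a stable isomorphism of direct sums; transitivity
is the one that uses cancellation. *)
Lemma K_eq_parts (x y : K_expr A) : K_eq F x y ->
  (K_parts x).1 |*| (K_parts y).2 =~ (K_parts y).1 |*| (K_parts x).2.
Proof.
elim=> {x y} /=.
- by move=> x; exact: sR.
- by move=> x y _; exact: stable_iso_sym.
- move=> x y z _ xy _ yz.
  apply: (@stable_cancel ((K_parts y).1 |*| (K_parts y).2)).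
  apply: stable_iso_trans (sC _ _) _; apply: stable_iso_trans (sAC _ _ _ _) _.
  apply: stable_iso_trans (stable_iso_prod xy yz) _.
  apply: stable_iso_trans (sAC _ _ _ _) _.
  exact: stable_iso_prod (sR _) (sR _).
- move=> x x' y y' _ xx' _ yy'; apply: stable_iso_trans (sACA _ _ _ _) _.
  apply: stable_iso_trans (stable_iso_prod xx' yy') _; exact: sACA.
- move=> x x' _ xx'; apply: stable_iso_trans (sC _ _) _.
  apply: stable_iso_trans (stable_iso_sym xx') _; exact: sC.
- by move=> x y z; apply: stable_iso_prod (sA _ _ _) (stable_iso_sym (sA _ _ _)).
- by move=> x y; exact: stable_iso_prod (sC _ _) (sC _ _).
- move=> x; have s0' X : fgmod0 A |*| X =~ X.
    exact: stable_iso_trans (sC _ _) (s0 _).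
  exact: stable_iso_prod (s0' _) (stable_iso_sym (s0' _)).
- move=> x; apply: stable_iso_trans (sC _ _) _.
  exact: stable_iso_prod (sR _) (sC _ _).
- move=> N X Y NXY; apply: stable_iso_prod (s0 _).
  exact: (@liso_stable_iso _ F N (X |*| Y)).
- move=> P Pp; apply: stable_iso_prod (sR _).
  apply: stable_iso_projective Pp _; apply: F_projective_zero.
  exact: fgmod0P.
Qed.

Lemma K_genP X Y : K_eq F (K_gen X) (K_gen Y) <-> X =~ Y.
Proof.
split=> [/K_eq_parts /= XY|/stable_isoP[P [Q [Pp Qp XY]]]].
  exact: stable_iso_trans (stable_iso_sym (s0 X)) (stable_iso_trans XY (s0 Y)).
have addP Z (S : fgmod A) : Fproj S -> K_eq F (K_gen (Z |*| S)) (K_gen Z).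
  move=> Sp; apply: K_trans (K_gen_prod F _ _) _.
  exact: K_trans (K_addE (K_refl _ _) (K_proj Sp)) (K_addr0 F _).
apply: K_trans (K_sym (addP X Q Qp)) _; apply: K_trans (addP Y P Pp).
apply: K_trans (@K_sum _ F (X |*| Q) Y P XY) _.
exact: K_sym (K_gen_prod F _ _).
Qed.

Lemma K_Omega_eq (x y : K_expr A) : K_eq F x y ->
  K_eq F (K_Omega F x) (K_Omega F y).
Proof.
elim=> {x y} /=.
- by move=> x; exact: K_refl.
- by move=> x y _; exact: K_sym.
- by move=> x y z _ xy _ yz; exact: K_trans xy yz.
- by move=> x x' y y' _ xx' _; exact: K_addE.
- by move=> x x' _; exact: K_oppE.
- by move=> x y z; exact: K_addA.
- by move=> x y; exact: K_addC.
- by move=> x; exact: K_add0.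
- by move=> x; exact: K_addN.
- move=> N X Y NXY; apply: (K_trans (y := K_gen (Omega F (X |*| Y)))).
    by apply/K_genP; apply: Omega_stable; exact: (@liso_stable_iso _ F N (X |*| Y)).
  apply: K_trans (K_gen_prod F _ _).
  by apply/K_genP; exact: Omega_prod.
- move=> P Pp; apply: K_trans (K_eq_zero_module F (@fgmod0P A)).
  by apply/K_genP; exact: Omega_projective.
Qed.

Lemma iter_K_Omega_eq n (x y : K_expr A) : K_eq F x y ->
  K_eq F (iter n (K_Omega F) x) (iter n (K_Omega F) y).
Proof. by elim: n => //= n IH /IH; exact: K_Omega_eq. Qed.

Lemma presentation_Omega K P Z (i : {linear K -> P}) (g : {linear P -> Z}) :
  presentation F i g -> K_eq F (K_gen K) (K_Omega F (K_gen Z)).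
Proof.
move=> pg /=; have [P' [i' [g' pg']]] := Omega_presentation Z.
by apply/K_genP; exact: (stable_syzygy pg pg' (sR Z)).
Qed.

End Covers.

(** * Relative extension functors and syzygies *)

Section ExtClasses.
Local Open Scope quotient_scope.
Variables (A : pzRingType) (F : ext_class A) (X : fgmod A) (d : nat).
Local Notation C := (F_resolution F X).
Variables (K : fgmod A) (i : {linear K -> term C d}).
Variable q : {linear term C d.+1 -> K}.

(** [K] is the image of the differential from degree [d.+1] to degree [d], that
is, the syzygy of [X] of order [d.+1]. *)
Definition is_syzygy_factorization :=
  [/\ forall k, exists x, q x = k, forall x, diff C d x = i (q x)
    & forall x, q x = 0 <-> exists y, diff C d.+1 y = x].

Implicit Types N : fgmod A.

Hypothesis iq : is_syzygy_factorization.

Lemma comp_cocycle N (h : {linear K -> N}) :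
  hcomp h q \in @cocycles A F d.+1 X N.
Proof.
have [_ _ kq] := iq; apply/asboolP/hom_ext => x /=.
have -> : q (diff C d.+1 x) = 0 by apply/kq; exists x.
exact: linear0.
Qed.

(** Cocycles of degree [d.+1] are the maps that factor through [K], and
coboundaries those that extend to the term of degree [d]; so [ext_of] presents
[Ext^(d+1)(X, N)] as the cokernel of [Hom(P_d, N) -> Hom(K, N)]. *)
Definition ext_of N (h : {linear K -> N}) : Ext F d.+1 X N :=
  \pi_(Ext F d.+1 X N) (Cocycle (comp_cocycle h)).

Lemma cocycle_factor N (z : cocycle F d.+1 X N) :
  exists h : {linear K -> N}, forall x,
    (cocycle_val z : {linear term C d.+1 -> N}) x = h (q x).
Proof.
have [qS _ kq] := iq; case: z => z /= /asboolP zd.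
have [x /kq[y <-]|h hE] := @factor_epi _ _ _ _ q (z : {linear _ -> _}) qS.
  exact: (congr1 (fun k : Defs.hom _ N => (k : {linear _ -> _}) y) zd).
by exists h.
Qed.

Lemma ext_of_surj N (x : Ext F d.+1 X N) : exists h, ext_of h = x.
Proof.
rewrite -[x]reprK; have [h hE] := cocycle_factor (repr x); exists h.
by congr (\pi _); apply: val_inj; apply: hom_ext => y; rewrite hE.
Qed.

Lemma pi_eq N (z z' : cocycle F d.+1 X N) :
  \pi_(Ext F d.+1 X N) z = \pi_(Ext F d.+1 X N) z' <->
  exists u : {linear term C d -> N}, forall x,
    (cocycle_val z : {linear term C d.+1 -> N}) x -
    (cocycle_val z' : {linear term C d.+1 -> N}) x = u (diff C d x).
Proof.
split.
  move=> /eqP; rewrite -Quotient.idealrBE => /asboolP[u uE].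
  exists (u : {linear _ -> _}) => x.
  exact: (congr1 (fun k : Defs.hom _ N => (k : {linear _ -> _}) x) uE).
move=> [u uE]; apply/eqP; rewrite -Quotient.idealrBE; apply/asboolP.
by exists (u : Defs.hom _ N); apply: hom_ext => x; exact: uE.
Qed.

Lemma ext_of_eq N (h h' : {linear K -> N}) : ext_of h = ext_of h' <->
  exists u : {linear term C d -> N}, forall k, h k - h' k = u (i k).
Proof.
have [qS dq _] := iq; rewrite pi_eq; split=> -[u uE]; exists u => k.
  by have [x <-] := qS k; rewrite -dq -uE.
by rewrite dq -uE.
Qed.

Lemma ext_of_add N (h h' : {linear K -> N}) :
  ext_of (h \+ h') = ext_of h + ext_of h'.
Proof.
rewrite /ext_of -[RHS]raddfD; congr (\pi _); apply: val_inj.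
by apply: hom_ext => x.
Qed.

Lemma ext_of_zero N : ext_of (\0 : {linear K -> N}) = 0.
Proof.
rewrite /ext_of -[RHS](raddf0 \pi_(Ext F d.+1 X N)); congr (\pi _).
by apply: val_inj; apply: hom_ext => x.
Qed.

Lemma Ext_map_ext_of N N' (f : {linear N -> N'}) (h : {linear K -> N}) :
  Ext_map f (ext_of h) = ext_of (f \o h).
Proof.
apply/pi_eq; have /pi_eq[u uE] := reprK (ext_of h).
exists (f \o u) => x /=; rewrite -uE linearB.
by [].
Qed.

End ExtClasses.

Section ExtIso.
Variables (A : pzRingType) (F : ext_class A) (X Y : fgmod A) (d : nat).
Variables (K L : fgmod A).
Variables (i : {linear K -> term (F_resolution F X) d}).
Variables (j : {linear L -> term (F_resolution F Y) d}).
Variable p : {linear term (F_resolution F X) d.+1 -> K}.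
Variable q : {linear term (F_resolution F Y) d.+1 -> L}.
Implicit Types N : fgmod A.
Hypotheses (ip : is_syzygy_factorization i p) (jq : is_syzygy_factorization j q).

Lemma zero_coboundary (h : {linear K -> term (F_resolution F X) d})
    (t : {linear term (F_resolution F X) d -> term (F_resolution F X) d}) :
  (forall k, h k = t (i k)) -> ext_of ip h = 0.
Proof.
by move=> ht; rewrite -(ext_of_zero ip); apply/ext_of_eq; exists t => k;
  rewrite subr0 ht.
Qed.

(** Yoneda: a natural transformation out of [Ext^(d+1)(X, -)] is determined by
the image of the class of the identity of the syzygy. *)
Lemma natural_map
    (theta : forall N, Ext F d.+1 X N -> Ext F d.+1 Y N) :
  (forall N N' (f : {linear N -> N'}) x,
    theta N' (Ext_map f x) = Ext_map f (theta N x)) ->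
  exists al : {linear L -> K}, forall N (h : {linear K -> N}),
    theta N (ext_of ip h) = ext_of jq (h \o al).
Proof.
move=> nat_theta; have [al alE] := ext_of_surj jq (theta K (ext_of ip idfun)).
exists al => N h; rewrite -Ext_map_ext_of alE -nat_theta Ext_map_ext_of.
by congr (theta N _); apply/ext_of_eq; exists \0 => k; rewrite subrr.
Qed.

(** The class of [i] in [Ext^(d+1)(X, P_d)] is zero since [i] extends to the term
[P_d] by the identity; its image, the class of [i al], is then zero too. *)
Lemma natural_map_extends
    (theta : forall N, Ext F d.+1 X N -> Ext F d.+1 Y N) (al : {linear L -> K}) :
  (forall N, {morph theta N : x y / x + y}) ->
  (forall N (h : {linear K -> N}), theta N (ext_of ip h) = ext_of jq (h \o al)) ->
  exists t : {linear term (F_resolution F Y) d -> term (F_resolution F X) d},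
    forall x, i (al x) = t (j x).
Proof.
move=> thD thE; have th0 : theta (term (F_resolution F X) d) 0 = 0.
  by apply: (addIr (theta _ 0)); rewrite -thD !add0r.
have := thE _ i; rewrite (@zero_coboundary i idfun) // th0.
rewrite -(ext_of_zero jq) => /esym/ext_of_eq[t tE].
by exists t => x; rewrite -tE subr0.
Qed.

(** Composition with [al] is well defined on classes because [al] extends to the
terms of the resolutions. *)
Lemma ext_of_comp (al : {linear L -> K})
    (t : {linear term (F_resolution F Y) d -> term (F_resolution F X) d}) :
  (forall x, i (al x) = t (j x)) ->
  forall N (h h' : {linear K -> N}), ext_of ip h = ext_of ip h' ->
    ext_of jq (h \o al) = ext_of jq (h' \o al).
Proof.
move=> it N h h' /ext_of_eq[u uE]; apply/ext_of_eq; exists (u \o t) => x /=.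
by rewrite -it -uE.
Qed.

End ExtIso.

Section ExtIsoHomotopic.
Variables (A : pzRingType) (F : ext_class A) (X Y : fgmod A) (d : nat).
Variables (K L : fgmod A).
Variables (i : {linear K -> term (F_resolution F X) d}).
Variables (j : {linear L -> term (F_resolution F Y) d}).
Variable p : {linear term (F_resolution F X) d.+1 -> K}.
Variable q : {linear term (F_resolution F Y) d.+1 -> L}.
Implicit Types N : fgmod A.
Hypotheses (ip : is_syzygy_factorization i p) (jq : is_syzygy_factorization j q).

Lemma Ext_iso_homotopic : Ext_iso F d.+1 X Y <-> homotopic i j.
Proof.
split=> [[th [thD thB thN]]|].
  pose th' N y := projT1 (cid (let: Bijective g _ gK := thB N in
    ex_intro (fun x => th N x = y) (g y) (gK y))).
  have thK' N y : th N (th' N y) = y by rewrite /th'; case: cid.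
  have thI N : injective (th N) by have [g gK _] := thB N; exact: can_inj gK.
  have th'K N x : th' N (th N x) = x by apply: thI.
  have th'D N : {morph th' N : x y / x + y}.
    by move=> x y; apply: thI; rewrite thD !thK'.
  have th'N N N' (f : {linear N -> N'}) y :
      th' N' (Ext_map f y) = Ext_map f (th' N y).
    by apply: thI; rewrite thN !thK'.
  have [al alE] := natural_map ip jq thN.
  have [be beE] := natural_map jq ip th'N.
  have [t tE] := natural_map_extends thD alE.
  have [t' t'E] := natural_map_extends th'D beE.
  exists al, be; split; split; [by exists t| |by exists t'|].
    have := th'K _ (ext_of ip idfun); rewrite alE beE => /esym/ext_of_eq[s sE].
    by exists s => x; rewrite -sE /= addrC subrK.
  have := thK' _ (ext_of jq idfun); rewrite beE alE => /esym/ext_of_eq[s sE].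
  by exists s => x; rewrite -sE /= addrC subrK.
move=> [al [be [[[t it] [s sE]] [[t' jt'] [s' s'E]]]]].
pose th N (x : Ext F d.+1 X N) : Ext F d.+1 Y N :=
  ext_of jq (projT1 (cid (ext_of_surj ip x)) \o al).
pose th' N (y : Ext F d.+1 Y N) : Ext F d.+1 X N :=
  ext_of ip (projT1 (cid (ext_of_surj jq y)) \o be).
have thE N (h : {linear K -> N}) : th N (ext_of ip h) = ext_of jq (h \o al).
  exact: (ext_of_comp jq it (projT2 (cid (ext_of_surj ip (ext_of ip h))))).
have th'E N (h : {linear L -> N}) : th' N (ext_of jq h) = ext_of ip (h \o be).
  exact: (ext_of_comp ip jt' (projT2 (cid (ext_of_surj jq (ext_of jq h))))).
exists th; split=> [N x y|N|N N' f x].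
- have [h <-] := ext_of_surj ip x; have [k <-] := ext_of_surj ip y.
  rewrite -ext_of_add !thE -ext_of_add; apply/ext_of_eq.
  by exists \0 => z; rewrite subrr.
- exists (th' N) => x.
    have [h <-] := ext_of_surj ip x; rewrite thE th'E; apply/ext_of_eq.
    by exists (\- (h \o s)) => k;
      rewrite /= {2}(sE k) linearD opprD addrA subrr add0r.
  have [h <-] := ext_of_surj jq x; rewrite th'E thE; apply/ext_of_eq.
  by exists (\- (h \o s')) => k;
    rewrite /= {2}(s'E k) linearD opprD addrA subrr add0r.
have [h <-] := ext_of_surj ip x; rewrite Ext_map_ext_of !thE Ext_map_ext_of.
by apply/ext_of_eq; exists \0 => z; rewrite subrr.
Qed.

End ExtIsoHomotopic.

Lemma F_resolution_ex (A : pzRingType) (F : ext_class A) (X : fgmod A) :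
  enough_projectives F -> exists r : augmented X, is_F_resolution F r.
Proof.
move=> hproj.
have [P [K [f [g PKfg]]]] : exists (P K : fgmod A -> fgmod A)
    (f : forall M, {linear K M -> P M}) (g : forall M, {linear P M -> M}),
    forall M, F_projective F (P M) /\ F_exact F (f M) (g M).
  pose cP M := cid (hproj M); pose cg M := cid (projT2 (cP M)).
  pose cK M := cid (projT2 (cg M)).2; pose cf M := cid (projT2 (cK M)).
  exists (fun M => projT1 (cP M)), (fun M => projT1 (cK M)).
  exists (fun M => projT1 (cf M)), (fun M => projT1 (cg M)) => M.
  by split; [exact: (projT2 (cg M)).1|exact: (projT2 (cf M))].
pose S n := iter n K X.
exists (@Augmented A X (fun n => P (S n)) (fun n => f (S n) \o g (S n.+1)) (g X)).
split=> [n|]; first exact: (PKfg (S n)).1.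
exists (fun n => S n.+1), (fun n => f (S n)), (fun n => g (S n.+1)).
split=> // [|n]; first exact: (PKfg X).2.
exact: (PKfg (S n.+1)).2.
Qed.

Section ExtSyzygy.
Variables (R : comNzRingType) (A : algType R) (F : ext_class A).
Hypotheses (hA : artin_algebra A) (hF : additive_subfunctor F).
Hypothesis hproj : enough_projectives F.

Lemma resolution_syzygy (X : fgmod A) d :
  exists (K Z : fgmod A) (i : {linear K -> term (F_resolution F X) d})
    (q : {linear term (F_resolution F X) d.+1 -> K})
    (g : {linear term (F_resolution F X) d -> Z}),
  [/\ is_syzygy_factorization i q, presentation F i g
    & K_eq F (K_gen Z) (iter d (K_Omega F) (K_gen X))].
Proof.
have : is_F_resolution F (F_resolution F X).
  apply: (@choose_spec _ _ (@is_F_resolution A F X)).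
  exact: F_resolution_ex.
move=> [Tp [K [i [q [dE e0 eS]]]]].
have fact n : is_syzygy_factorization (i n) (q n).
  have [[_ kq qS] _] := eS n; have [[_ _ qS'] _] := eS n.+1.
  split=> // x; rewrite kq; split=> [[k <-]|[y <-]].
    by have [y <-] := qS' k; exists y; rewrite dE.
  by exists (q n.+1 y); rewrite dE.
have pres0 : presentation F (i 0%N) (augm (F_resolution F X)).
  split=> //; first by case: e0.
  by apply: F_epi_lifts; exists (K 0%N), (i 0%N).
have presS n : presentation F (i n.+1) (q n).
  split=> //; first by case: (eS n).
  by apply: F_epi_lifts; exists (K n.+1), (i n.+1).
have KE n : K_eq F (K_gen (K n)) (iter n.+1 (K_Omega F) (K_gen X)).
  elim: n => [|n IHn]; first exact: presentation_Omega pres0.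
  apply: K_trans (presentation_Omega hA hF hproj (presS n)) _.
  exact: K_Omega_eq IHn.
case: d => [|d].
  exists (K 0%N), X, (i 0%N), (q 0%N), (augm (F_resolution F X)).
  by split=> //; exact: K_refl.
by exists (K d.+1), (K d), (i d.+1), (q d.+1), (q d).
Qed.

(** Turns the conditions on [Ext] in a division into relations between classes of
syzygies. *)
Lemma Ext_iso_K_eq (X Y : fgmod A) d : Ext_iso F d.+1 X Y <->
  K_eq F (iter d (K_Omega F) (K_gen X)) (iter d (K_Omega F) (K_gen Y)).
Proof.
have [K [Z [i [p [g [ip pig ZX]]]]]] := resolution_syzygy X d.
have [L [W [j [q [g' [jq pjg WY]]]]]] := resolution_syzygy Y d.
rewrite (Ext_iso_homotopic ip jq); split=> [h|XY].
  apply: K_trans (K_sym ZX) (K_trans _ WY).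
  by apply/K_genP => //; exact: homotopic_stable pig pjg h.
apply: stable_homotopic pig pjg _; apply/(K_genP F hA).
exact: K_trans ZX (K_trans XY (K_sym WY)).
Qed.

End ExtSyzygy.

(** * Sums of indecomposables and the span of a module *)

Section Sums.
Variables (A : pzRingType) (F : ext_class A).
Implicit Types (X : fgmod A) (N : nat -> fgmod A) (a b : nat -> nat).

Fixpoint power X k : fgmod A :=
  if k is k'.+1 then prod_fgmod X (power X k') else fgmod0 A.

Fixpoint wsum n N a : fgmod A :=
  if n is n'.+1 then prod_fgmod (power (N n') (a n')) (wsum n' N a)
  else fgmod0 A.

Lemma through_power (C : fgmod A -> Prop) X k :
  ((0 < k)%N -> through C (idfun : {linear X -> X})) ->
  through C (idfun : {linear power X k -> power X k}).
Proof.
elim: k => [_|k IH tX].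
  by apply: through0 => x; exact: fgmod0P.
apply: through_id_prod; first exact: tX.
by apply: IH => _; exact: tX.
Qed.

Lemma through_wsum (C : fgmod A -> Prop) n N a :
  (forall i, (i < n)%N -> (0 < a i)%N -> through C (idfun : {linear N i -> N i})) ->
  through C (idfun : {linear wsum n N a -> wsum n N a}).
Proof.
elim: n => [_|n IH tN].
  by apply: through0 => x; exact: fgmod0P.
apply: through_id_prod; first by apply: through_power; exact: tN.
by apply: IH => i ni; apply: tN; exact: ltnW.
Qed.

Lemma wsum_ext n N a b : (forall i, (i < n)%N -> a i = b i) ->
  wsum n N a = wsum n N b.
Proof.
elim: n => //= n IH ab; rewrite ab // IH // => i ni; exact/ab/ltnW.
Qed.

Lemma K_gen_fgmod0 : K_eq F (K_gen (fgmod0 A)) (K_zero A).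
Proof. apply: K_eq_zero_module; exact: fgmod0P. Qed.

Lemma K_power X j k : K_eq F (K_gen (power X (j + k)))
  (K_add (K_gen (power X j)) (K_gen (power X k))).
Proof.
elim: j => [|j IH]; apply: K_sym.
  exact: K_trans (K_addE K_gen_fgmod0 (K_refl _ _)) (K_add0 _ _).
apply: K_trans (K_sym (K_gen_prod _ _ _)).
apply: K_trans (K_addE (K_gen_prod _ _ _) (K_refl _ _)) _.
apply: K_trans (K_sym (K_addA _ _ _ _)) _.
exact: K_addE (K_refl _ _) (K_sym IH).
Qed.

Lemma K_wsum n N a b : K_eq F (K_gen (wsum n N (fun i => a i + b i)%N))
  (K_add (K_gen (wsum n N a)) (K_gen (wsum n N b))).
Proof.
elim: n => [|n IH] /=.
  apply: K_sym; exact: K_trans (K_addE K_gen_fgmod0 (K_refl _ _)) (K_add0 _ _).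
apply: K_trans (K_gen_prod _ _ _) _.
apply: K_trans (K_addE (K_power _ _ _) IH) _.
apply: K_trans (K_addACA _ _ _ _ _) _.
exact: K_addE (K_sym (K_gen_prod _ _ _)) (K_sym (K_gen_prod _ _ _)).
Qed.

Lemma K_wsum0 n N : K_eq F (K_gen (wsum n N (fun=> 0%N))) (K_zero A).
Proof.
apply: K_eq_zero_module; elim: n => [|n IH] /=; first exact: fgmod0P.
by case=> x y; rewrite (fgmod0P x) (IH y).
Qed.

Lemma K_wsum_delta n N i : (i < n)%N ->
  K_eq F (K_gen (wsum n N (fun j => (j == i : nat)))) (K_gen (N i)).
Proof.
elim: n => // n IH; rewrite ltnS leq_eqVlt => /orP[/eqP->|ni] /=;
  apply: K_trans (K_gen_prod _ _ _) _.
  rewrite eqxx (@wsum_ext n N _ (fun=> 0%N)) => [|j jn]; last by rewrite ltn_eqF.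
  apply: K_trans (K_addE _ (K_wsum0 _ _)) (K_addr0 F _) => /=.
  apply: K_trans (K_gen_prod _ _ _) _.
  exact: K_trans (K_addE (K_refl _ _) K_gen_fgmod0) (K_addr0 F _).
rewrite gtn_eqF //=; apply: K_trans (K_add0 _ _).
exact: K_addE K_gen_fgmod0 (IH ni).
Qed.

End Sums.

Section Main.
Variables (R : comNzRingType) (A : algType R) (F : ext_class A).
Hypotheses (hA : artin_algebra A) (hF : additive_subfunctor F).
Hypothesis hproj : enough_projectives F.
Variable M : fgmod A.
Local Notation Fproj := (F_projective F).
Implicit Types (X Y Z : fgmod A) (a b : nat -> nat) (x y : K_expr A).

Local Notation "x =K y" := (K_eq F x y) (at level 70).

Lemma in_add_retract X Y : in_add M Y -> retract X Y -> in_add M X.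
Proof.
move=> /in_add_through tY XY; apply/in_add_through.
exact: through_id_retract XY tY.
Qed.

Lemma K_span_in_add X : in_add M X -> K_span F M (K_gen X).
Proof.
elim/(fgmod_ind hA): X => X.
- move=> X0 _; apply: K_span_eq (K_span0 F M).
  exact: K_sym (K_eq_zero_module F X0).
- move=> Xi MX; have [Xp|Xp] := pselect (Fproj X).
    exact: K_span_eq (K_sym (K_proj Xp)) (K_span0 F M).
  have [_ <- XM] := through_id_indecomposable hA Xi ((in_add_through _ _).1 MX).
  by apply: K_span_gen => //; apply/retract_summand.
move=> Y Z XYZ IHY IHZ MX; apply: K_span_eq (K_sym (K_sum F XYZ)) _.
have YX : retract Y X by apply/retract_summand; exists Z.
have ZX : retract Z X.
  by apply/retract_summand; exists Y; exact: liso_trans XYZ (liso_prodC _ _).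
apply: K_spanD; [apply: IHY|apply: IHZ]; exact: in_add_retract MX _.
Qed.

(** [Omega] maps [Omega^m <M>] onto [Omega^(m+1) <M>], so only injectivity is at
stake, and it can be tested on [<M>] itself. *)
Lemma Omega_span_isoP m : Omega_span_iso F M m <->
  forall x, K_span F M x -> iter m.+1 (K_Omega F) x =K K_zero A ->
    iter m (K_Omega F) x =K K_zero A.
Proof.
split=> [[_ inj _] x Mx x0|ker].
  apply: inj => //; first by exists x => //; exact: K_refl.
  exists (K_zero A); first exact: K_span0.
  by rewrite iter_K_Omega_zero; exact: K_refl.
split.
- move=> x [y My yx]; exists y => //; exact: K_Omega_eq yx.
- move=> x x' [y My yx] [y' My' yx'] xx'.
  apply: K_trans (K_sym yx) (K_trans _ yx'); apply/K_sub_eq0.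
  rewrite -iter_K_Omega_opp -iter_K_Omega_add; apply: ker.
    by apply: K_spanD => //; exact: K_spanN.
  rewrite iter_K_Omega_add iter_K_Omega_opp; apply/K_sub_eq0.
  apply: K_trans (K_Omega_eq hA hF hproj yx) (K_trans xx' _).
  exact: K_sym (K_Omega_eq hA hF hproj yx').
- move=> y [x Mx xy]; exists (iter m (K_Omega F) x) => //.
  by exists x => //; exact: K_refl.
Qed.

Variables (n : nat) (N : nat -> fgmod A).
Hypothesis Nindec : forall i, (i < n)%N -> indecomposable (N i).
Hypothesis Nsummand : forall i, (i < n)%N -> is_summand (N i) M.
Hypothesis Ndistinct : forall i j, (i < j < n)%N -> ~ liso (N i) (N j).
Hypothesis Ncomplete : forall X, indecomposable X -> ~ Fproj X ->
  is_summand X M -> exists2 i, (i < n)%N & liso X (N i).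

Local Notation S := (wsum n N).

(** The relation [Omega^m (sum_i (a i - b i) [N i]) = 0], written without
differences. *)
Definition syzygy_eq m a b :=
  iter m (K_Omega F) (K_gen (S a)) =K iter m (K_Omega F) (K_gen (S b)).

Lemma in_add_wsum a : in_add M (S a).
Proof.
apply/in_add_through/through_wsum => i ni _; apply/in_add_through.
have Mi : retract (N i) M by apply/retract_summand; exact: Nsummand.
apply: in_add_retract Mi; apply/in_add_through.
exact: (through1 (s := idfun) (r := idfun) erefl).
Qed.

Lemma iter_K_Omega_wsum m a b :
  iter m (K_Omega F) (K_gen (S (fun i => a i + b i)%N)) =K
  K_add (iter m (K_Omega F) (K_gen (S a))) (iter m (K_Omega F) (K_gen (S b))).
Proof.
rewrite -iter_K_Omega_add; apply: iter_K_Omega_eq => //; exact: K_wsum.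
Qed.

Lemma syzygy_eq_shift m a b a' b' :
  (forall i, (i < n)%N -> a i + b' i = a' i + b i)%N ->
  syzygy_eq m a b -> syzygy_eq m a' b'.
Proof.
move=> ab E; apply: (@K_addI _ _ _ _ (iter m (K_Omega F) (K_gen (S b)))).
apply: K_trans (K_sym (iter_K_Omega_wsum m a' b)) _.
rewrite -(wsum_ext N ab); apply: K_trans (iter_K_Omega_wsum m a b') _.
exact: K_trans (K_addE E (K_refl _ _)) (K_addC _ _ _).
Qed.

Lemma K_span_wsum x : K_span F M x ->
  exists a b, K_add x (K_gen (S b)) =K K_gen (S a).
Proof.
elim=> {x}.
- move=> X Xi Xp XM; have [i ni XNi] := Ncomplete Xi Xp XM.
  exists (fun j => (j == i : nat)), (fun=> 0%N).
  apply: K_trans (K_addE (K_refl _ _) (K_wsum0 _ _ _)) _.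
  apply: K_trans (K_addr0 F _) (K_trans _ (K_sym (K_wsum_delta _ _ ni))).
  by apply/(K_genP F hA); exact: liso_stable_iso.
- by exists (fun=> 0%N), (fun=> 0%N); exact: K_add0.
- move=> x y _ [a [b xab]] _ [a' [b' yab]].
  exists (fun i => a i + a' i)%N, (fun i => b i + b' i)%N.
  apply: K_trans (K_addE (K_refl _ _) (K_wsum _ _ _ _ _)) _.
  apply: K_trans (K_addACA _ _ _ _ _) _.
  exact: K_trans (K_addE xab yab) (K_sym (K_wsum _ _ _ _ _)).
- move=> x _ [a [b xab]]; exists b, a.
  apply: K_trans (K_addE (K_refl _ _) (K_sym xab)) _.
  apply: K_trans (K_addA _ _ _ _) _.
  exact: K_trans (K_addE (K_addN _ _) (K_refl _ _)) (K_add0 _ _).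
- move=> x y xy _ [a [b xab]]; exists a, b.
  exact: K_trans (K_addE (K_sym xy) (K_refl _ _)) xab.
Qed.

Lemma iter_K_Omega_eq0 m x a b : K_add x (K_gen (S b)) =K K_gen (S a) ->
  iter m (K_Omega F) x =K K_zero A <-> syzygy_eq m a b.
Proof.
move=> /(iter_K_Omega_eq hA hF hproj m); rewrite iter_K_Omega_add => xab.
split=> [x0|E].
  apply: K_trans (K_sym xab) _.
  exact: K_trans (K_addE x0 (K_refl _ _)) (K_add0 _ _).
apply: (@K_addI _ _ _ _ (iter m (K_Omega F) (K_gen (S b)))).
exact: K_trans xab (K_trans E (K_sym (K_add0 _ _))).
Qed.

Lemma Omega_span_iso_wsum m : Omega_span_iso F M m <->
  forall a b, syzygy_eq m.+1 a b -> syzygy_eq m a b.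
Proof.
rewrite Omega_span_isoP; split=> [ker a b E|inj x /K_span_wsum[a [b xab]]].
  have ab : K_add (K_add (K_gen (S a)) (K_opp (K_gen (S b)))) (K_gen (S b)) =K
      K_gen (S a).
    apply: K_trans (K_sym (K_addA _ _ _ _)) _.
    exact: K_trans (K_addE (K_refl _ _) (K_addN _ _)) (K_addr0 F _).
  apply/(iter_K_Omega_eq0 m ab)/ker; last exact/(iter_K_Omega_eq0 m.+1 ab).
  apply: K_spanD; first exact/K_span_in_add/in_add_wsum.
  exact/K_spanN/K_span_in_add/in_add_wsum.
by move=> /(iter_K_Omega_eq0 m.+1 xab)/inj/(iter_K_Omega_eq0 m xab).
Qed.

(** The kernels of [Z^n -> <M> -> Omega^m <M>] form an ascending chain of
subgroups of [Z^n]. *)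
Lemma Omega_span_iso_eventually :
  exists k, forall m, (k <= m)%N -> Omega_span_iso F M m.
Proof.
pose T m : set 'rV[int]_n := fun v => exists a b,
  (forall i : 'I_n, v 0 i = (a i)%:Z - (b i)%:Z) /\ syzygy_eq m a b.
have [|m|m v [a [b [vE E]]]|k kP] := @row_acc int n T.
- exact: int_noetherian.
- have T0 : T m 0.
    exists (fun=> 0%N), (fun=> 0%N); split=> [i|]; last exact: K_refl.
    by rewrite mxE subrr.
  have TD v w : T m v -> T m w -> T m (v + w).
    move=> [a [b [vE E]]] [a' [b' [wE E']]].
    exists (fun i => a i + a' i)%N, (fun i => b i + b' i)%N; split=> [i|].
      by rewrite mxE vE wE !PoszD opprD addrACA.
    apply: K_trans (iter_K_Omega_wsum _ _ _) _.
    exact: K_trans (K_addE E E') (K_sym (iter_K_Omega_wsum _ _ _)).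
  have TN v : T m v -> T m (- v).
    move=> [a [b [vE E]]]; exists b, a; split=> [i|]; last exact: K_sym.
    by rewrite mxE vE opprB.
  have TZ (p : nat) v : T m v -> T m (p%:Z *: v).
    move=> Tv; elim: p => [|p IH]; first by rewrite scale0r.
    by rewrite intS scalerDl scale1r; exact: TD.
  split=> // -[p|p] v Tv; first exact: TZ.
  by rewrite NegzE scaleNr; apply/TN/TZ.
- exists a, b; split=> //; exact: K_Omega_eq.
exists k => m km; apply/Omega_span_iso_wsum => a b E.
pose v : 'rV[int]_n := \row_(i < n) ((a i)%:Z - (b i)%:Z).
have [a' [b' [vE E']]] : T m v.
  rewrite kP // -(kP m.+1 (leqW km)); exists a, b; split=> // i.
  by rewrite mxE.
apply: syzygy_eq_shift E' => i ni.
have := vE (Ordinal ni); rewrite mxE /= => /eqP.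
rewrite subr_eq addrAC eq_sym subr_eq -!PoszD => /eqP[->].
by [].
Qed.

(** By locality an indecomposable module in [add (S c)] is some [N i] with
[0 < c i], and the [N i] are pairwise non-isomorphic. *)
Lemma wsum_disjoint a b Z : (forall i, (0 < a i)%N -> (0 < b i)%N -> False) ->
  in_add (S a) Z -> in_add (S b) Z -> is_zero Z.
Proof.
move=> ab.
have add_wsum c Y : indecomposable Y -> in_add (S c) Y ->
    exists i, [/\ (i < n)%N, (0 < c i)%N & liso Y (N i)].
  move=> Yi /in_add_through tY.
  pose C X := exists2 i, (i < n)%N & (0 < c i)%N /\ X = N i.
  have tC : through C (idfun : {linear Y -> Y}).
    apply: through_sub tY => _ <-; apply: through_wsum => i ni ci.
    by apply: (through1 (s := idfun) (r := idfun)) => //; exists i.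
  have [_ [i ni [ci ->]] YNi] := through_id_indecomposable hA Yi tC.
  exists i; split=> //; apply: indecomposable_retract YNi; first exact: Nindec.
  by case: Yi.
have retr c Y Y' : in_add (S c) Y -> retract Y' Y -> in_add (S c) Y'.
  move=> /in_add_through tY YY'; apply/in_add_through.
  exact: through_id_retract YY' tY.
elim/(fgmod_ind hA): Z => Z; first by [].
  move=> Zi /(add_wsum _ _ Zi)[i [ni ai Zi1]] /(add_wsum _ _ Zi)[j [nj bj Zj]].
  have Nij := liso_trans (liso_sym Zi1) Zj.
  have [ij|ji|ij] := ltngtP i j.
  - by case: (@Ndistinct i j); rewrite ?ij.
  - by case: (@Ndistinct j i); rewrite ?ji //; exact: liso_sym.
  - by case: (ab j) => //; rewrite -ij.
move=> X Y ZXY IHX IHY aZ bZ; apply: is_zero_liso (liso_sym ZXY) _.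
have XZ : retract X Z by apply/retract_summand; exists Y.
have YZ : retract Y Z.
  by apply/retract_summand; exists X; exact: liso_trans ZXY (liso_prodC _ _).
have X0 : is_zero X by apply: IHX; exact: retr XZ.
have Y0 : is_zero Y by apply: IHY; exact: retr YZ.
by case=> x y; rewrite (X0 x) (Y0 y).
Qed.

(** An element of [<M>] killed by [Omega^(d+1)] but not by [Omega^d], written as
a difference of modules without common summands, gives a division. *)
Lemma division_of_kernel d : ~ Omega_span_iso F M d ->
  exists X Y, relative_division F d.+1 M X Y.
Proof.
move=> /Omega_span_iso_wsum/existsNP[a /existsNP[b /not_implyP[E nE]]].
pose a' i := (a i - b i)%N; pose b' i := (b i - a i)%N.
have ab' i : (i < n)%N -> (a i + b' i = a' i + b i)%N.
  by move=> _; rewrite /a' /b' -!maxnE [LHS]maxnC addnC -maxnE.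
exists (S a'), (S b'); split.
- by split; exact: in_add_wsum.
- move=> Z; apply: wsum_disjoint => i; rewrite /a' /b' !subn_gt0 => ba.
  by rewrite ltnNge ltnW.
- move=> /(Ext_iso_K_eq hA hF hproj) E'; apply: nE.
  by apply: syzygy_eq_shift E' => i ni; rewrite ab'.
- by apply/(Ext_iso_K_eq hA hF hproj); exact: syzygy_eq_shift E.
Qed.

Lemma kernel_of_division d X Y : relative_division F d.+1 M X Y ->
  ~ Omega_span_iso F M d.
Proof.
move=> [[MX MY] _ nE E] /Omega_span_isoP inj; apply: nE.
apply/(Ext_iso_K_eq hA hF hproj)/K_sub_eq0.
rewrite -iter_K_Omega_opp -iter_K_Omega_add; apply: inj.
  by apply: K_spanD; [|apply: K_spanN]; exact: K_span_in_add.
rewrite iter_K_Omega_add iter_K_Omega_opp; apply/K_sub_eq0.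
exact/(Ext_iso_K_eq hA hF hproj).
Qed.

End Main.

(** By locality every indecomposable summand of [M] occurs in one fixed
decomposition, which bounds the number of isomorphism classes. *)
Lemma indecomposable_family (R : comNzRingType) (A : algType R)
    (F : ext_class A) (M : fgmod A) : artin_algebra A ->
  exists n (N : nat -> fgmod A),
  [/\ forall i, (i < n)%N -> indecomposable (N i),
      forall i, (i < n)%N -> is_summand (N i) M,
      forall i j, (i < j < n)%N -> ~ liso (N i) (N j)
    & forall X : fgmod A, indecomposable X -> ~ F_projective F X ->
        is_summand X M -> exists2 i, (i < n)%N & liso X (N i)].
Proof.
move=> hA; have [n [N [Ni tM]]] := through_indecomposables hA M.
have [m [L [QL Ld NL]]] :=
  liso_representatives (fun X => indecomposable X /\ is_summand X M) n N.
exists m, L; split=> // [i im|i im|X Xi _ XM]; [by case: (QL i im)..|].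
have tX : through (fun X => exists2 i, (i < n)%N & X = N i)
    (idfun : {linear X -> X}).
  by apply: through_id_retract tM; apply/retract_summand.
have [_ [i ni ->] XNi] := through_id_indecomposable hA Xi tX.
have XN : liso X (N i) by apply: indecomposable_retract XNi; [exact: Ni|case: Xi].
have [j jm NLj] : exists2 j, (j < m)%N & liso (N i) (L j).
  apply: NL => //; split; first exact: Ni.
  apply/retract_summand; apply: retract_trans (liso_retract (liso_sym XN)) _.
  exact/retract_summand.
by exists j => //; exact: liso_trans NLj.
Qed.

Theorem theorem4p8 (R : comNzRingType) (A : algType R) (F : ext_class A)
    (G M : fgmod A)
    (hA : artin_algebra A)
    (hF : additive_subfunctor F)
    (hF0 : nonzero_class F)
    (hproj : enough_projectives F)
    (hinj : enough_injectives F)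
    (hG : forall P : fgmod A, F_projective F P <-> in_add G P) :
  exists k : nat,
    phi_dim_is F M k /\
    is_max ([set d | (0 < d)%N /\
                     exists X Y : fgmod A, relative_division F d M X Y]
            `|` [set 0%N])%classic k.
Proof.
have [n [N [Ni Ns Nd Nc]]] := indecomposable_family F M hA.
pose stable j := forall m, (j <= m)%N -> Omega_span_iso F M m.
have ex : exists j, `[< stable j >].
  have [j jP] := Omega_span_iso_eventually hA hF hproj Ns Nc.
  by exists j; apply/asboolP.
(* [phi-dim] is the least degree [k] from which [Omega] is injective; if
   [k = d.+1], minimality makes it fail to be injective in degree [d]. *)
have [k /asboolP k_stable k_min] := ex_minnP ex.
exists k; split; first by split=> // j jP; apply: k_min; apply/asboolP.
split.
  case: k k_stable k_min => [|d] d_stable d_min; first by right.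
  left; split=> //; apply: (division_of_kernel hA hF hproj Ni Ns Nd Nc) => dP.
  have /d_min : `[< stable d >].
    apply/asboolP => m; rewrite leq_eqVlt => /orP[/eqP<- //|].
    exact: d_stable.
  by rewrite ltnn.
move=> d [[d_gt0 [X [Y XY]]]|-> //]; case: d d_gt0 XY => // d _ XY.
rewrite ltnNge; apply/negP => kd.
exact: (kernel_of_division hA hF hproj XY (k_stable d kd)).
Qed.
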